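(* Let $D=\left(\frac{a,b}{K}\right)$ be a quaternion division algebra over $K$ with $a,b\in\mathcal{O}_K^*$, and let $\tau$ be its canonical involution. Take $\epsilon=1$, $\sigma=\tau$ and $\pi'=\pi$. Then Larmour's isomorphism $\partial=(\partial_0,\partial_1)$ is an isomorphism $$W^{1}\left(\left(\tfrac{a,b}{K}\right),\tau\right)\cong W^{1}\left(\left(\tfrac{\overline a,\overline b}{k}\right),\overline\tau\right)\oplus W^{1}\left(\left(\tfrac{\overline a,\overline b}{k}\right),\overline\tau\right),$$ and on one-dimensional forms it is given as follows. For $\delta\in\mathcal{O}_K^*$, the image of the unramified hermitian form $\langle\delta\rangle$ under $\partial_0$ is $\langle\overline\delta\rangle$. For $\delta\in K$ with $\nu_K(\delta)=1$, the image of the ramified hermitian form $\langle\delta\rangle$ under $\partial_1$ is $\langle\overline{\pi^{-1}\delta}\rangle$.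
   Context: $K$ is a complete discretely valued field with normalized valuation $\nu_K$, valuation ring $\mathcal{O}_K$, uniformizer $\pi$ and residue field $k$ of characteristic $\neq2$. $D=\left(\frac{a,b}{K}\right)$ has $K$-basis $1,x,y,z$ with $x^2=a$, $y^2=b$, $z=xy=-yx$. $\nu_D(d)=\frac12\nu_K(\mathrm{Nrd}(d))$ extends $\nu_K$ to $D$; $\mathcal{O}_D=\{\nu_D\ge0\}$, $m_D=\{\nu_D>0\}$ (both with $0$), $\overline D=\mathcal{O}_D/m_D$, and a bar denotes reduction modulo $m_D$. When $a,b$ are units, $\overline D\cong\left(\frac{\overline a,\overline b}{k}\right)$, a quaternion division algebra, and $\nu_D$ has value group $\mathbb{Z}$. Every $K$-linear involution $\sigma$ of $D$ preserves $\mathcal{O}_D,m_D$ and induces $\overline\sigma$ on $\overline D$. $\tau(x)=-x$, $\tau(y)=-y$, $\tau(z)=-z$. For $\lambda\in D^*$, $\sigma_\lambda(d)=\lambda\sigma(d)\lambda^{-1}$. $W^\epsilon(E,\rho)$ is the Witt group of nondegenerate $\epsilon$-hermitian forms over a division algebra with involution $(E,\rho)$, and $\langle u_1,\dots,u_r\rangle$ is the diagonal form with $\rho(u_i)=\epsilon u_i$. Larmour's isomorphism: given an $\epsilon$-symmetric uniformizer $\pi'$ of $D$ (i.e. $\sigma(\pi')=\epsilon\pi'$ and $\nu_D(\pi')$ is the least positive value of $\nu_D$), every $\epsilon$-hermitian form over $(D,\sigma)$ is isometric to $h_0\perp h_1$ with $h_0=\langle u_1,\dots,u_p\rangle$, $\nu_D(u_i)=0$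 (unramified), and $h_1=\langle v_1,\dots,v_q\rangle$, $\nu_D(v_i)=\nu_D(\pi')$ (ramified). Set $\overline{h_0}=\langle\overline{u_1},\dots,\overline{u_p}\rangle$ and $\overline{h_1}=\langle\overline{v_1\pi'^{-1}},\dots,\overline{v_q\pi'^{-1}}\rangle$. Then $\partial:W^\epsilon(D,\sigma)\to W^\epsilon(\overline D,\overline\sigma)\oplus W^1(\overline D,\overline{\sigma_{\pi'}})$, $[h]\mapsto([\overline{h_0}],[\overline{h_1}])$, is Larmour's (well-defined) group isomorphism. *)

(* Defs.v *)
From HB Require Import structures.
From mathcomp Require Import all_boot all_order all_algebra.
From mathcomp Require Import boolp ring.

Set Implicit Arguments.
Unset Strict Implicit.
Unset Printing Implicit Defensive.

Import Order.TTheory GRing.Theory Num.Theory.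
Local Open Scope ring_scope.
Local Open Scope quotient_scope.

(** * Rings with involution, hermitian forms, Witt groups *)

Record involution (E : nzRingType) := Involution {
  invol_fun :> E -> E;
  involD : {morph invol_fun : x y / x + y};
  involM : forall x y, invol_fun (x * y) = invol_fun y * invol_fun x;
  involK : forall x, invol_fun (invol_fun x) = x }.

Definition division_ring (E : unitRingType) : Prop :=
  forall x : E, x != 0 -> x \is a GRing.unit.

Section Involution.
Variables (E : nzRingType) (rho : involution E).

Lemma invol0 : rho 0 = 0.
Proof. by apply: (addrI (rho 0)); rewrite -involD !addr0. Qed.

Lemma involN x : rho (- x) = - rho x.
Proof. by apply: (addrI (rho x)); rewrite -involD !subrr invol0. Qed.

Lemma invol1 : rho 1 = 1.
Proof.
have := involM rho 1 (rho 1); rewrite mul1r involK => e.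
by rewrite -[LHS]mul1r -e.
Qed.

Lemma invol_sum I (r : seq I) (P : pred I) (F : I -> E) :
  rho (\sum_(i <- r | P i) F i) = \sum_(i <- r | P i) rho (F i).
Proof. exact: (big_morph rho (involD rho) invol0). Qed.

Lemma invol_sign (e : bool) x : rho ((-1) ^+ e * x) = (-1) ^+ e * rho x.
Proof. by case: e; rewrite ?expr1 ?expr0 ?mulN1r ?involN // !mul1r. Qed.

End Involution.

Section Forms.
Variables (E : nzRingType) (eps : bool) (rho : involution E).

(* A nondegenerate (-1)^eps-hermitian form on the left E-module E^n of row
   vectors; over a division ring every finite-dimensional space is of this
   shape.  The form is E-linear on the left and rho-semilinear on the right. *)
Record hform := HForm {
  hdim : nat;
  hval :> 'rV[E]_hdim -> 'rV[E]_hdim -> E;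
  hvalDl : forall x y z, hval (x + y) z = hval x z + hval y z;
  hvalZl : forall c x y, hval (c *: x) y = c * hval x y;
  hvalC : forall x y, hval y x = (-1) ^+ eps * rho (hval x y);
  hval_nondeg : forall x, (forall y, hval x y = 0) -> x = 0 }.

Lemma hvalDr (h : hform) x y z : h x (y + z) = h x y + h x z.
Proof. by rewrite !(hvalC _ x) hvalDl involD mulrDr. Qed.

Lemma hvalZr (h : hform) c x y : h x (c *: y) = h x y * rho c.
Proof. by rewrite hvalC hvalZl involM mulrA -hvalC. Qed.

Definition isometric (h1 h2 : hform) : Prop :=
  exists f : {linear 'rV[E]_(hdim h1) -> 'rV[E]_(hdim h2)},
    bijective f /\ forall x y, h2 (f x) (f y) = h1 x y.

Lemma isometricI (h1 h2 : hform) f g : linear f -> cancel f g -> cancel g f ->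
  (forall x y, h2 (f x) (f y) = h1 x y) -> isometric h1 h2.
Proof.
move=> lf fK gK fh.
pose F := GRing.isLinear.Build _ _ _ _ f lf.
pose G : {linear 'rV[E]_(hdim h1) -> 'rV[E]_(hdim h2)} := HB.pack f F.
by exists G; split=> //; exists g.
Qed.

Lemma isometric_refl h : isometric h h.
Proof. by apply: (@isometricI h h id id). Qed.

Lemma isometric_sym h1 h2 : isometric h1 h2 -> isometric h2 h1.
Proof.
case=> f [[g fK gK] fh]; apply: (@isometricI h2 h1 g f) => //.
- by move=> c x y; apply: (can_inj fK); rewrite linearP !gK.
- by move=> x y; rewrite -fh !gK.
Qed.

Lemma isometric_trans h2 h1 h3 :
  isometric h1 h2 -> isometric h2 h3 -> isometric h1 h3.
Proof.
case=> f [[g fK gK] fh] [f' [[g' fK' gK'] fh']].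
apply: (@isometricI h1 h3 (f' \o f) (g \o g')).
- by move=> c x y; rewrite /= !linearP.
- exact: can_comp.
- exact: can_comp.
- by move=> x y /=; rewrite fh' fh.
Qed.

Lemma hval0r (h : hform) x : h x 0 = 0.
Proof. by rewrite -(scale0r 0) hvalZr invol0 mulr0. Qed.

Section Osum.
Variables h1 h2 : hform.

Definition osum_val (x y : 'rV[E]_(hdim h1 + hdim h2)) : E :=
  h1 (lsubmx x) (lsubmx y) + h2 (rsubmx x) (rsubmx y).

Fact osum_Dl x y z : osum_val (x + y) z = osum_val x z + osum_val y z.
Proof. by rewrite /osum_val !linearD !hvalDl addrACA. Qed.

Fact osum_Zl c x y : osum_val (c *: x) y = c * osum_val x y.
Proof. by rewrite /osum_val !linearZ !hvalZl mulrDr. Qed.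

Fact osum_C x y : osum_val y x = (-1) ^+ eps * rho (osum_val x y).
Proof. by rewrite /osum_val involD mulrDr -!hvalC. Qed.

Fact osum_nondeg x : (forall y, osum_val x y = 0) -> x = 0.
Proof.
move=> x0; rewrite -[x]hsubmxK.
have -> : lsubmx x = 0.
  apply: hval_nondeg => y; move: (x0 (row_mx y 0)).
  by rewrite /osum_val row_mxKl row_mxKr hval0r addr0.
have -> : rsubmx x = 0.
  apply: hval_nondeg => y; move: (x0 (row_mx 0 y)).
  by rewrite /osum_val row_mxKl row_mxKr hval0r add0r.
by rewrite row_mx0.
Qed.

Definition osum : hform := HForm osum_Dl osum_Zl osum_C osum_nondeg.

End Osum.

Fact hzero_nondeg (x : 'rV[E]_0) : (forall y : 'rV[E]_0, 0 = 0 :> E) -> x = 0.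
Proof. by move=> _; apply/rowP=> -[]. Qed.

Fact hzero_Dl (x y z : 'rV[E]_0) : 0 = 0 + 0 :> E.
Proof. by rewrite addr0. Qed.

Fact hzero_Zl c (x y : 'rV[E]_0) : 0 = c * 0 :> E.
Proof. by rewrite mulr0. Qed.

Fact hzero_C (x y : 'rV[E]_0) : 0 = (-1) ^+ eps * rho 0 :> E.
Proof. by rewrite invol0 mulr0. Qed.

Definition hzero : hform :=
  @HForm 0 (fun _ _ => 0) hzero_Dl hzero_Zl hzero_C hzero_nondeg.

Section Opp.
Variable h : hform.

Fact hopp_Dl x y z : - h (x + y) z = - h x z + - h y z.
Proof. by rewrite hvalDl opprD. Qed.

Fact hopp_Zl c x y : - h (c *: x) y = c * - h x y.
Proof. by rewrite hvalZl mulrN. Qed.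

Fact hopp_C x y : - h y x = (-1) ^+ eps * rho (- h x y).
Proof. by rewrite involN mulrN -hvalC. Qed.

Fact hopp_nondeg x : (forall y, - h x y = 0) -> x = 0.
Proof. by move=> x0; apply: hval_nondeg => y; apply/oppr_inj; rewrite x0 oppr0. Qed.

Definition hopp : hform := HForm hopp_Dl hopp_Zl hopp_C hopp_nondeg.

End Opp.

(* L is a Lagrangian: a subspace equal to its own orthogonal.  (Being an
   orthogonal, L is automatically a subspace.)  When 2 is invertible in a
   division ring E the metabolic forms are exactly the hyperbolic ones. *)
Definition metabolic (h : hform) : Prop :=
  exists L : 'rV[E]_(hdim h) -> Prop,
    forall x, L x <-> (forall y, L y -> h x y = 0).

Definition witt_equiv (h1 h2 : hform) : Prop :=
  exists m1 m2 : hform,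
    [/\ metabolic m1, metabolic m2 & isometric (osum h1 m1) (osum h2 m2)].

Lemma osum_isometric h1 h1' h2 h2' : isometric h1 h1' -> isometric h2 h2' ->
  isometric (osum h1 h2) (osum h1' h2').
Proof.
case=> f [[g fK gK] fh] [f' [[g' fK' gK'] fh']].
apply: (@isometricI (osum h1 h2) (osum h1' h2')
  (fun x => row_mx (f (lsubmx x)) (f' (rsubmx x)))
  (fun x => row_mx (g (lsubmx x)) (g' (rsubmx x)))).
- by move=> c x y; rewrite !linearP scale_row_mx add_row_mx.
- by move=> x; rewrite row_mxKl row_mxKr fK fK' hsubmxK.
- by move=> x; rewrite row_mxKl row_mxKr gK gK' hsubmxK.
- by move=> x y; rewrite /= /osum_val !row_mxKl !row_mxKr fh fh'.
Qed.

Lemma osumC h1 h2 : isometric (osum h1 h2) (osum h2 h1).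
Proof.
apply: (@isometricI (osum h1 h2) (osum h2 h1)
  (fun x => row_mx (rsubmx x) (lsubmx x))
  (fun x => row_mx (rsubmx x) (lsubmx x))).
- by move=> c x y; rewrite !linearP scale_row_mx add_row_mx.
- by move=> x; rewrite row_mxKl row_mxKr hsubmxK.
- by move=> x; rewrite row_mxKl row_mxKr hsubmxK.
- by move=> x y; rewrite /= /osum_val !row_mxKl !row_mxKr addrC.
Qed.

Lemma osumA h1 h2 h3 :
  isometric (osum h1 (osum h2 h3)) (osum (osum h1 h2) h3).
Proof.
apply: (@isometricI (osum h1 (osum h2 h3)) (osum (osum h1 h2) h3)
  (fun x => row_mx (row_mx (lsubmx x) (lsubmx (rsubmx x))) (rsubmx (rsubmx x)))
  (fun x => row_mx (lsubmx (lsubmx x)) (row_mx (rsubmx (lsubmx x)) (rsubmx x)))).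
- by move=> c x y; rewrite !linearP !scale_row_mx !add_row_mx.
- by move=> x; rewrite !(row_mxKl, row_mxKr) !hsubmxK.
- by move=> x; rewrite !(row_mxKl, row_mxKr) !hsubmxK.
- by move=> x y; rewrite /= /osum_val /= /osum_val !(row_mxKl, row_mxKr) addrA.
Qed.

Lemma osum0h h : isometric (osum hzero h) h.
Proof.
apply: (@isometricI (osum hzero h) h (fun x => rsubmx (x : 'rV_(0 + _)))
  (fun x => row_mx (0 : 'rV_0) x)).
- by move=> c x y; rewrite !linearP.
- by move=> x; rewrite -[RHS]hsubmxK; congr row_mx; apply/rowP=> -[].
- by move=> x; rewrite row_mxKr.
- by move=> x y; rewrite /= /osum_val add0r.
Qed.

Lemma osumACA h1 h2 h3 h4 : isometric (osum (osum h1 h2) (osum h3 h4))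
                                      (osum (osum h1 h3) (osum h2 h4)).
Proof.
apply: (isometric_trans _ (osumA _ _ _)).
apply: (isometric_trans (isometric_sym (osumA _ _ _))).
apply: osum_isometric; first exact: isometric_refl.
apply: (isometric_trans (osumA _ _ _)).
apply: (isometric_trans _ (isometric_sym (osumA _ _ _))).
by apply: osum_isometric; [exact: osumC | exact: isometric_refl].
Qed.

Lemma metabolic0 : metabolic hzero.
Proof. by exists (fun=> True) => x; split. Qed.

Lemma metabolic_osum h1 h2 :
  metabolic h1 -> metabolic h2 -> metabolic (osum h1 h2).
Proof.
case=> L1 L1P [L2 L2P].
have L10 : L1 0 by apply/L1P => y _; rewrite -(scale0r 0) hvalZl mul0r.
have L20 : L2 0 by apply/L2P => y _; rewrite -(scale0r 0) hvalZl mul0r.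
exists (fun x : 'rV_(_ + _) => L1 (lsubmx x) /\ L2 (rsubmx x)) => x; split.
  move=> [Lx1 Lx2] y [Ly1 Ly2] /=; rewrite /osum_val.
  by rewrite (proj1 (L1P _) Lx1 _ Ly1) (proj1 (L2P _) Lx2 _ Ly2) addr0.
move=> xL; split.
  apply/L1P=> y Ly; move: (xL (row_mx y 0)).
  rewrite /= /osum_val row_mxKl row_mxKr hval0r addr0; exact.
apply/L2P=> y Ly; move: (xL (row_mx 0 y)).
rewrite /= /osum_val row_mxKl row_mxKr hval0r add0r; exact.
Qed.

Lemma metabolic_opp h : metabolic (osum (hopp h) h).
Proof.
exists (fun x : 'rV_(_ + _) => lsubmx x = rsubmx x) => x; split.
  by move=> ex y ey; rewrite /= /osum_val /= ex ey addNr.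
move=> xL; apply/eqP; rewrite -subr_eq0; apply/eqP.
apply: (@hval_nondeg h) => y; move: (xL (row_mx y y)).
rewrite /= /osum_val /= row_mxKl row_mxKr => /(_ erefl)/eqP.
rewrite addrC subr_eq0 => /eqP e.
by rewrite hvalDl -scaleN1r hvalZl mulN1r -e subrr.
Qed.

Lemma isometric_equiv h1 h2 : isometric h1 h2 -> witt_equiv h1 h2.
Proof.
move=> i; exists hzero, hzero; split; try exact: metabolic0.
by apply: osum_isometric => //; apply: isometric_refl.
Qed.

Lemma witt_equiv_refl h : witt_equiv h h.
Proof. exact/isometric_equiv/isometric_refl. Qed.

Lemma witt_equiv_sym h1 h2 : witt_equiv h1 h2 -> witt_equiv h2 h1.
Proof. by case=> m1 [m2 [? ? /isometric_sym ?]]; exists m2, m1. Qed.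

Lemma witt_equiv_trans h2 h1 h3 :
  witt_equiv h1 h2 -> witt_equiv h2 h3 -> witt_equiv h1 h3.
Proof.
case=> m1 [m2 [M1 M2 i12]] [m3 [m4 [M3 M4 i34]]].
exists (osum m1 m3), (osum m2 m4).
split; try exact: metabolic_osum.
apply: (isometric_trans (osumA _ _ _)).
apply: (isometric_trans (osum_isometric i12 (isometric_refl m3))).
apply: (isometric_trans (isometric_sym (osumA _ _ _))).
apply: (isometric_trans (osum_isometric (isometric_refl h2) (osumC m2 m3))).
apply: (isometric_trans (osumA _ _ _)).
apply: (isometric_trans (osum_isometric i34 (isometric_refl m2))).
apply: (isometric_trans (isometric_sym (osumA _ _ _))).
exact: (osum_isometric (isometric_refl h3) (osumC m4 m2)).
Qed.

Lemma osum_equiv h1 h1' h2 h2' : witt_equiv h1 h1' -> witt_equiv h2 h2' ->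
  witt_equiv (osum h1 h2) (osum h1' h2').
Proof.
case=> m1 [m2 [M1 M2 i12]] [m3 [m4 [M3 M4 i34]]].
exists (osum m1 m3), (osum m2 m4); split; try exact: metabolic_osum.
apply: (isometric_trans (osumACA _ _ _ _)).
by apply: (isometric_trans (osum_isometric i12 i34)); apply: osumACA.
Qed.

Lemma hopp_isometric h1 h2 : isometric h1 h2 -> isometric (hopp h1) (hopp h2).
Proof. by case=> f [bf fh]; exists f; split=> // x y /=; rewrite fh. Qed.

Lemma hopp_osum h1 h2 :
  isometric (hopp (osum h1 h2)) (osum (hopp h1) (hopp h2)).
Proof.
apply: (@isometricI (hopp (osum h1 h2)) (osum (hopp h1) (hopp h2)) id id) => //.
by move=> x y; rewrite /= /osum_val /= opprD.
Qed.

Lemma metabolic_hopp h : metabolic h -> metabolic (hopp h).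
Proof.
case=> L LP; exists L => x; split=> [/LP Lx y /Lx /= ->|xL]; first by rewrite oppr0.
by apply/LP=> y /xL /= /eqP; rewrite oppr_eq0 => /eqP.
Qed.

Lemma hopp_equiv h1 h2 : witt_equiv h1 h2 -> witt_equiv (hopp h1) (hopp h2).
Proof.
case=> m1 [m2 [M1 M2 /hopp_isometric i]]; exists (hopp m1), (hopp m2).
split; try exact: metabolic_hopp.
apply: (isometric_trans (isometric_sym (hopp_osum _ _))).
exact: (isometric_trans i (hopp_osum _ _)).
Qed.

Lemma metabolic_equiv0 h : metabolic h -> witt_equiv h hzero.
Proof.
by move=> M; exists hzero, h; split=> //; [exact: metabolic0 | exact: osumC].
Qed.

HB.instance Definition _ := gen_eqMixin hform.
HB.instance Definition _ := gen_choiceMixin hform.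

Definition witt_rel (h1 h2 : hform) : bool := `[< witt_equiv h1 h2 >].

Fact witt_rel_refl : reflexive witt_rel.
Proof. by move=> h; apply/asboolP/witt_equiv_refl. Qed.

Fact witt_rel_sym : symmetric witt_rel.
Proof.
by move=> h1 h2; apply/asboolP/asboolP; apply: witt_equiv_sym.
Qed.

Fact witt_rel_trans : transitive witt_rel.
Proof.
move=> h2 h1 h3 /asboolP e /asboolP e'.
exact/asboolP/(witt_equiv_trans e e').
Qed.

Canonical witt_equiv_rel := EquivRel witt_rel
  witt_rel_refl witt_rel_sym witt_rel_trans.

(* The Witt group W^{(-1)^eps}(E, rho). *)
Definition witt : Type := {eq_quot witt_equiv_rel}.

HB.instance Definition _ := Choice.on witt.
HB.instance Definition _ : EqQuotient _ witt_equiv_rel witt :=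
  EqQuotient.on witt.

Definition witt_class (h : hform) : witt := \pi_witt h.

Lemma witt_classP h1 h2 :
  reflect (witt_equiv h1 h2) (witt_class h1 == witt_class h2).
Proof. by rewrite /witt_class eqmodE; apply: asboolP. Qed.

Lemma witt_class_eq h1 h2 : witt_equiv h1 h2 -> witt_class h1 = witt_class h2.
Proof. by move=> e; apply/eqP/witt_classP. Qed.

Lemma witt_class_repr w : witt_class (repr w) = w.
Proof. exact: reprK. Qed.

Lemma witt_equiv_repr h : witt_equiv (repr (witt_class h)) h.
Proof. by apply/witt_classP; rewrite witt_class_repr. Qed.

Lemma witt_ind (P : witt -> Prop) : (forall h, P (witt_class h)) -> forall w, P w.
Proof. by move=> Ph w; rewrite -(witt_class_repr w). Qed.

Definition witt_add (w1 w2 : witt) : witt :=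
  witt_class (osum (repr w1) (repr w2)).
Definition witt_opp (w : witt) : witt := witt_class (hopp (repr w)).
Definition witt_zero : witt := witt_class hzero.

Lemma witt_addE h1 h2 :
  witt_add (witt_class h1) (witt_class h2) = witt_class (osum h1 h2).
Proof. by apply: witt_class_eq; apply: osum_equiv; apply: witt_equiv_repr. Qed.

Lemma witt_oppE h : witt_opp (witt_class h) = witt_class (hopp h).
Proof. by apply: witt_class_eq; apply: hopp_equiv; apply: witt_equiv_repr. Qed.

Fact witt_addA : associative witt_add.
Proof.
elim/witt_ind=> h1; elim/witt_ind=> h2; elim/witt_ind=> h3.
by rewrite !witt_addE; apply/witt_class_eq/isometric_equiv/osumA.
Qed.

Fact witt_addC : commutative witt_add.
Proof.
elim/witt_ind=> h1; elim/witt_ind=> h2.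
by rewrite !witt_addE; apply/witt_class_eq/isometric_equiv/osumC.
Qed.

Fact witt_add0 : left_id witt_zero witt_add.
Proof.
elim/witt_ind=> h; rewrite witt_addE.
exact/witt_class_eq/isometric_equiv/osum0h.
Qed.

Fact witt_addN : left_inverse witt_zero witt_opp witt_add.
Proof.
elim/witt_ind=> h; rewrite witt_oppE witt_addE.
exact/witt_class_eq/metabolic_equiv0/metabolic_opp.
Qed.

HB.instance Definition _ :=
  GRing.isZmodule.Build witt witt_addA witt_addC witt_add0 witt_addN.

Lemma witt_classD h1 h2 :
  witt_class (osum h1 h2) = witt_class h1 + witt_class h2.
Proof. exact: esym (witt_addE h1 h2). Qed.

End Forms.

Section Diagonal.
Variables (E : unitRingType) (eps : bool) (rho : involution E).

(* <u_1, ..., u_r> is defined when rho u_i = (-1)^eps u_i and the u_i are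
   invertible. *)
Definition diag_ok (u : seq E) : bool :=
  all (fun c => (rho c == (-1) ^+ eps * c) && (c \is a GRing.unit)) u.

Variables (u : seq E) (uP : diag_ok u).

Definition diag_val (x y : 'rV[E]_(size u)) : E :=
  \sum_(i < size u) x 0 i * u`_i * rho (y 0 i).

Fact diag_Dl x y z : diag_val (x + y) z = diag_val x z + diag_val y z.
Proof.
by rewrite /diag_val -big_split; apply: eq_bigr => i _; rewrite mxE !mulrDl.
Qed.

Fact diag_Zl c x y : diag_val (c *: x) y = c * diag_val x y.
Proof.
by rewrite /diag_val mulr_sumr; apply: eq_bigr => i _; rewrite mxE !mulrA.
Qed.

Fact diag_C x y : diag_val y x = (-1) ^+ eps * rho (diag_val x y).
Proof.
rewrite /diag_val invol_sum mulr_sumr; apply: eq_bigr => i _.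
have /andP[/eqP e _] := elimT (all_nthP 0) uP i (ltn_ord i).
rewrite !involM involK e mulrA [in RHS]mulrA mulrA.
have -> : (-1) ^+ eps * y 0 i = y 0 i * (-1) ^+ eps by rewrite commr_sign.
by congr (_ * _); rewrite -mulrA [_ ^+ _ * (_ * _)]mulrA -expr2 sqrr_sign mul1r.
Qed.

Fact diag_nondeg x : (forall y, diag_val x y = 0) -> x = 0.
Proof.
move=> x0; apply/rowP=> i; rewrite [RHS]mxE.
have /andP[_ ui] := elimT (all_nthP 0) uP i (ltn_ord i).
apply: (mulIr ui); rewrite mul0r; have := x0 (delta_mx 0 i); rewrite /diag_val.
rewrite (bigD1 i) //= mxE !eqxx invol1 mulr1 big1 ?addr0 // => j ji.
by rewrite mxE (negPf ji) andbF invol0 mulr0.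
Qed.

Definition diag_form : hform eps rho :=
  HForm diag_Dl diag_Zl diag_C diag_nondeg.

End Diagonal.

(** * Valuations and residue maps *)

(* [nu] is only meaningful on nonzero elements; its value at 0 is never used. *)
Section ValuationRings.
Variables (A : nzRingType) (T : numDomainType) (nu : A -> T).

Definition val_ring : {pred A} := [pred x | (x == 0) || (0 <= nu x)].
Definition val_max : {pred A} := [pred x | (x == 0) || (0 < nu x)].
Definition val_units : {pred A} := [pred x | (x != 0) && (nu x == 0)].

End ValuationRings.

Record normalized_valuation (K : fieldType) (v : K -> int) : Prop := {
  valM : forall x y, x != 0 -> y != 0 -> v (x * y) = v x + v y;
  valD : forall x y, x != 0 -> y != 0 -> x + y != 0 ->
    Order.min (v x) (v y) <= v (x + y);
  val_onto : forall n : int, exists2 x, x != 0 & v x = n }.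

Definition val_close (K : fieldType) (v : K -> int) (N : int) (x y : K) : Prop :=
  x = y \/ N <= v (x - y).

Definition val_complete (K : fieldType) (v : K -> int) : Prop :=
  forall s : nat -> K,
    (forall N : int, exists n0 : nat, forall m n : nat,
       (n0 <= m)%N -> (n0 <= n)%N -> val_close v N (s m) (s n)) ->
    exists l : K, forall N : int, exists n0 : nat, forall n : nat,
      (n0 <= n)%N -> val_close v N (s n) l.

(* r presents B as the quotient ring O / m of the subring O of A; the values
   of r outside O are irrelevant. *)
Record residue_map (A B : nzRingType) (O m : {pred A}) (r : A -> B) : Prop := {
  res_dom : subring_closed O;
  res1 : r 1 = 1;
  resD : {in O &, {morph r : x y / x + y}};
  resM : {in O &, {morph r : x y / x * y}};
  res_ker : {in O, forall x, r x = 0 <-> x \in m};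
  res_onto : forall z : B, exists2 x, x \in O & r x = z }.

(** * Larmour's map *)

Section Larmour.
Variables (D : unitRingType) (nu : D -> rat) (eps : bool) (sigma : involution D).
Variable pi' : D.

Definition twist (lambda d : D) : D := lambda * sigma d * lambda^-1.

Definition sym_uniformizer : Prop :=
  [/\ pi' != 0, sigma pi' = (-1) ^+ eps * pi', 0 < nu pi'
    & forall d, d != 0 -> 0 < nu d -> nu pi' <= nu d].

Variables (Dbar : unitRingType) (red : D -> Dbar).

Definition induces (s : D -> D) (sbar : Dbar -> Dbar) : Prop :=
  {in val_ring nu, forall d, s d \in val_ring nu /\ red (s d) = sbar (red d)}.

Variables s0 s1 : involution Dbar.

(* pi' is an eps-symmetric uniformizer, Dbar = O_D / m_D with reduction map
   red, and s0, s1 are the involutions of Dbar induced by sigma and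
   sigma_pi'. *)
Definition larmour_setting : Prop :=
  [/\ sym_uniformizer, residue_map (val_ring nu) (val_max nu) red,
      induces sigma s0 & induces (twist pi') s1].

(* h is isometric to <u> _|_ <v>, <u> unramified and <v> ramified. *)
Definition larmour_decomposition (h : hform eps sigma) (u v : seq D) : Prop :=
  exists (uP : diag_ok eps sigma u) (vP : diag_ok eps sigma v),
    [/\ {in u, forall c, nu c = 0}, {in v, forall c, nu c = nu pi'}
      & isometric h (osum (diag_form uP) (diag_form vP))].

Definition larmour_map (del : witt eps sigma -> witt eps s0 * witt false s1) :
    Prop :=
  forall h : hform eps sigma,
    (exists u v, larmour_decomposition h u v) /\
    forall u v, larmour_decomposition h u v ->
    exists (ubP : diag_ok eps s0 [seq red c | c <- u])
           (vbP : diag_ok false s1 [seq red (c * pi'^-1) | c <- v]),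
      del (witt_class h) =
        (witt_class (diag_form ubP), witt_class (diag_form vbP)).

End Larmour.

(** * Quaternion algebras *)

(* Quat c0 c1 c2 c3 stands for c0 + c1 x + c2 y + c3 z with x^2 = a, y^2 = b,
   z = x y = - y x. *)
Record quat (F : fieldType) (a b : F) :=
  Quat { qc0 : F; qc1 : F; qc2 : F; qc3 : F }.
Arguments Quat {F a b}.

Section Quaternions.
Variables (F : fieldType) (a b : F).
Local Notation Q := (quat a b).
Implicit Types d e : Q.

Definition quat_tuple d := (qc0 d, qc1 d, qc2 d, qc3 d).
Definition tuple_quat (t : F * F * F * F) : Q :=
  let: (c0, c1, c2, c3) := t in Quat c0 c1 c2 c3.
Fact quat_tupleK : cancel quat_tuple tuple_quat.
Proof. by case. Qed.

HB.instance Definition _ := Choice.copy Q (can_type quat_tupleK).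

Lemma quatP d e : qc0 d = qc0 e -> qc1 d = qc1 e -> qc2 d = qc2 e ->
  qc3 d = qc3 e -> d = e.
Proof. by case: d e => [? ? ? ?] [? ? ? ?] /= -> -> -> ->. Qed.

Definition quat_add d e : Q :=
  Quat (qc0 d + qc0 e) (qc1 d + qc1 e) (qc2 d + qc2 e) (qc3 d + qc3 e).
Definition quat_opp d : Q := Quat (- qc0 d) (- qc1 d) (- qc2 d) (- qc3 d).
Definition quat_mul d e : Q :=
  Quat (qc0 d * qc0 e + a * (qc1 d * qc1 e) + b * (qc2 d * qc2 e)
          - a * b * (qc3 d * qc3 e))
       (qc0 d * qc1 e + qc1 d * qc0 e - b * (qc2 d * qc3 e)
          + b * (qc3 d * qc2 e))
       (qc0 d * qc2 e + qc2 d * qc0 e + a * (qc1 d * qc3 e)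
          - a * (qc3 d * qc1 e))
       (qc0 d * qc3 e + qc3 d * qc0 e + qc1 d * qc2 e - qc2 d * qc1 e).
Definition quat_scale (c : F) d : Q :=
  Quat (c * qc0 d) (c * qc1 d) (c * qc2 d) (c * qc3 d).

Local Ltac quat_ring := repeat intro; apply: quatP => /=; ring.

Fact quat_addA : associative quat_add. Proof. quat_ring. Qed.
Fact quat_addC : commutative quat_add. Proof. quat_ring. Qed.
Fact quat_add0 : left_id (Quat 0 0 0 0) quat_add. Proof. quat_ring. Qed.
Fact quat_addN : left_inverse (Quat 0 0 0 0) quat_opp quat_add.
Proof. quat_ring. Qed.
HB.instance Definition _ :=
  GRing.isZmodule.Build Q quat_addA quat_addC quat_add0 quat_addN.

Fact quat_mulA : associative quat_mul. Proof. quat_ring. Qed.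
Fact quat_mul1 : left_id (Quat 1 0 0 0) quat_mul. Proof. quat_ring. Qed.
Fact quat_1mul : right_id (Quat 1 0 0 0) quat_mul. Proof. quat_ring. Qed.
Fact quat_mulDl : left_distributive quat_mul +%R. Proof. quat_ring. Qed.
Fact quat_mulDr : right_distributive quat_mul +%R. Proof. quat_ring. Qed.
Fact quat_1neq0 : (Quat 1 0 0 0 : Q) != 0.
Proof. by apply/eqP => -[/eqP]; rewrite oner_eq0. Qed.
HB.instance Definition _ := GRing.Zmodule_isNzRing.Build Q
  quat_mulA quat_mul1 quat_1mul quat_mulDl quat_mulDr quat_1neq0.

Fact quat_scaleA c c' d : quat_scale c (quat_scale c' d) = quat_scale (c * c') d.
Proof. quat_ring. Qed.
Fact quat_scale1 : left_id 1 quat_scale. Proof. quat_ring. Qed.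
Fact quat_scaleDr : right_distributive quat_scale +%R. Proof. quat_ring. Qed.
Fact quat_scaleDl d : {morph quat_scale^~ d : c c' / c + c'}.
Proof. quat_ring. Qed.
HB.instance Definition _ := GRing.Zmodule_isLmodule.Build F Q
  quat_scaleA quat_scale1 quat_scaleDr quat_scaleDl.

Fact quat_scaleAl c d e : c *: (d * e) = (c *: d) * e. Proof. quat_ring. Qed.
HB.instance Definition _ := GRing.Lmodule_isLalgebra.Build F Q quat_scaleAl.
Fact quat_scaleAr c d e : c *: (d * e) = d * (c *: e). Proof. quat_ring. Qed.
HB.instance Definition _ := GRing.Lalgebra_isAlgebra.Build F Q quat_scaleAr.

Definition quat_x : Q := Quat 0 1 0 0.
Definition quat_y : Q := Quat 0 0 1 0.
Definition quat_z : Q := Quat 0 0 0 1.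

Lemma quat_xx : quat_x * quat_x = a%:A. Proof. quat_ring. Qed.
Lemma quat_yy : quat_y * quat_y = b%:A. Proof. quat_ring. Qed.
Lemma quat_xy : quat_x * quat_y = quat_z. Proof. quat_ring. Qed.
Lemma quat_yx : quat_y * quat_x = - quat_z. Proof. quat_ring. Qed.
Lemma quat_basis d :
  d = qc0 d *: 1 + qc1 d *: quat_x + qc2 d *: quat_y + qc3 d *: quat_z.
Proof. quat_ring. Qed.

Definition quat_conj d : Q := Quat (qc0 d) (- qc1 d) (- qc2 d) (- qc3 d).

Fact quat_conjD : {morph quat_conj : d e / d + e}. Proof. quat_ring. Qed.
Fact quat_conjM d e : quat_conj (d * e) = quat_conj e * quat_conj d.
Proof. quat_ring. Qed.
Fact quat_conjK d : quat_conj (quat_conj d) = d. Proof. quat_ring. Qed.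

Definition canonical_involution : involution Q :=
  Involution quat_conjD quat_conjM quat_conjK.

Definition Nrd d : F :=
  qc0 d ^+ 2 - a * qc1 d ^+ 2 - b * qc2 d ^+ 2 + a * b * qc3 d ^+ 2.

Lemma NrdE d : d * quat_conj d = (Nrd d)%:A.
Proof. by rewrite /Nrd; quat_ring. Qed.
Lemma NrdE' d : quat_conj d * d = (Nrd d)%:A.
Proof. by rewrite /Nrd; quat_ring. Qed.
Lemma NrdM d e : Nrd (d * e) = Nrd d * Nrd e.
Proof. by rewrite /Nrd /=; ring. Qed.
Lemma Nrd1 : Nrd 1 = 1. Proof. by rewrite /Nrd /=; ring. Qed.

Definition quat_unit : pred Q := fun d => Nrd d != 0.
Definition quat_inv d : Q :=
  if Nrd d != 0 then (Nrd d)^-1 *: quat_conj d else d.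

Fact quat_mulVr : {in quat_unit, left_inverse 1 quat_inv *%R}.
Proof.
move=> d; rewrite unfold_in /quat_inv => d0; rewrite d0.
by rewrite -scalerAl NrdE' scalerA mulVf ?scale1r.
Qed.
Fact quat_divrr : {in quat_unit, right_inverse 1 quat_inv *%R}.
Proof.
move=> d; rewrite unfold_in /quat_inv => d0; rewrite d0.
by rewrite -scalerAr NrdE scalerA mulVf ?scale1r.
Qed.
Fact quat_unitP d e : e * d = 1 /\ d * e = 1 -> quat_unit d.
Proof.
case=> _ /(congr1 Nrd); rewrite NrdM Nrd1 /quat_unit => ne.
by apply/eqP => d0; move/eqP: ne; rewrite d0 mul0r eq_sym oner_eq0.
Qed.
Fact quat_inv_out : {in [predC quat_unit], quat_inv =1 id}.
Proof. by move=> d; rewrite inE unfold_in /quat_inv => /negPf ->. Qed.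
HB.instance Definition _ := GRing.NzRing_hasMulInverse.Build Q
  quat_mulVr quat_divrr quat_unitP quat_inv_out.

Definition nuD (v : F -> int) d : rat := (v (Nrd d))%:~R / 2%:R.

End Quaternions.

(* The reduction map O_D -> O_D / m_D, under the identification of O_D / m_D
   with (abar, bbar / k) that sends the classes of x and y to x and y; that it
   does present O_D / m_D is part of [larmour_setting]. *)
Definition quat_red (K k : fieldType) (res : K -> k) (a b : K) (d : quat a b) :
    quat (res a) (res b) :=
  Quat (res (qc0 d)) (res (qc1 d)) (res (qc2 d)) (res (qc3 d)).

(* Main.v *)
From HB Require Import structures.
From mathcomp Require Import all_boot all_order all_algebra.
From mathcomp Require Import boolp ring zify.
Require Import Defs.
Import Order.TTheory GRing.Theory Num.Theory.

Set Implicit Arguments.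
Unset Strict Implicit.
Unset Printing Implicit Defensive.

Local Open Scope ring_scope.

(** Completeness enters only through one consequence of Hensel's lemma: every
    element of 1 + m is a square in K ([hensel_sqrt]).  Rescaling one coordinate
    by such a square root turns a zero of a form modulo m into an exact zero.
    Applied to the norm form <1, -a, -b, ab>, this shows that the residue
    quaternion algebra is again a division algebra ([residue_division]).
    Consequently the valuation of a quaternion is the least valuation of its
    four coordinates ([nu_geE]), the valuation ring and its maximal ideal are
    described coordinatewise, and reduction is coordinatewise reduction.

    A tau-symmetric quaternion is a scalar.  Every hermitian form is therefore
    <u> _|_ <w> with entries in K, where multiplication by squares has brought the
    valuations to 0 in u and to 1 in w ([diagonal_decomposition]).

    The residue classes depend only on the Witt class because the residues of a
    metabolic form are metabolic ([metabolic_residue]).  Let L be a Lagrangian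
    of <u> _|_ <w> in D^n, and reduce the u-components of L cap O^n.  The image is
    totally isotropic for the residue form.  If z is orthogonal to the image and
    y is a lift of z, then pi^-1 h(-, y) is integral on L cap O^n, which is
    a direct summand of O^n; so on L it agrees with an integral functional on O^n
    ([integral_functional]).  The latter is h(-, s), where pi s is integral and
    its u-components lie in m.  Then y - pi s lies in L and still lifts z.
    Multiplication of the form by pi^-1 exchanges the roles of u and w and gives
    the second residue ([metabolic_swap]).
    A difference of two forms in the same Witt class is metabolic
    ([witt0_metabolic]), so equal classes have equal residues.

    For injectivity, represent a class by an anisotropic form
    ([witt_anisotropic]).  By Hensel's lemma its two residue forms are
    anisotropic too ([anisotropic_residue]).  An anisotropic form whose Witt
    class is zero has dimension zero ([anisotropic_witt0]); so if both residue
    classes vanish, the form is zero.  Surjectivity holds because diagonal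
    entries of residue forms are nonzero scalars of k, which lift to units of K. *)

(** * Hermitian forms and diagonal forms *)

Section FormBasics.
Variables (E : nzRingType) (eps : bool) (rho : involution E).
Local Notation form := (hform eps rho).
Implicit Types h : form.

Lemma hval0l h y : h 0 y = 0.
Proof. by rewrite -(scale0r 0) hvalZl mul0r. Qed.

Lemma hvalNl h x y : h (- x) y = - h x y.
Proof. by rewrite -scaleN1r hvalZl mulN1r. Qed.

Lemma hvalBl h x y z : h (x - y) z = h x z - h y z.
Proof. by rewrite hvalDl hvalNl. Qed.

Lemma hvalNr h x y : h x (- y) = - h x y.
Proof. by rewrite -scaleN1r hvalZr involN invol1 mulrN1. Qed.

Lemma hval_sym0 h x y : h x y = 0 -> h y x = 0.
Proof. by move=> e; rewrite hvalC e invol0 mulr0. Qed.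

Definition anisotropic h := forall x, h x x = 0 -> x = 0.

(** Multiplying the values by a cancellable constant does not change
    orthogonality, so Lagrangians correspond.  The constant is 1 for isometries
    and pi^-1 when the two residues of a form are exchanged. *)
Lemma similar_metabolic h1 h2 (c : E) (f : 'rV_(hdim h1) -> 'rV_(hdim h2)) g :
  (forall d, c * d = 0 -> d = 0) ->
  cancel f g -> cancel g f ->
  (forall x y, h2 (f x) (f y) = c * h1 x y) -> metabolic h1 -> metabolic h2.
Proof.
move=> c0 fK gK fh [L LP]; exists (fun y => L (g y)) => y; rewrite LP.
split=> yL.
  by move=> z Lz; rewrite -[y]gK -[z]gK fh yL ?mulr0.
move=> z Lz; apply: c0; rewrite -fh gK; apply: yL; by rewrite fK.
Qed.

Lemma isometric_metabolic h1 h2 : isometric h1 h2 -> metabolic h1 -> metabolic h2.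
Proof.
case=> f [[g fK gK] fh]; apply: (similar_metabolic (c := 1) _ fK gK) => [d|x y].
  by rewrite mul1r.
by rewrite fh mul1r.
Qed.

Lemma isometric_anisotropic h1 h2 :
  isometric h1 h2 -> anisotropic h1 -> anisotropic h2.
Proof.
case=> f [[g fK gK] fh] a1 x x0; rewrite -[x]gK (a1 (g x)) ?raddf0 //.
by rewrite -fh gK.
Qed.

Lemma osum_anisotropic h1 h2 :
  anisotropic (osum h1 h2) -> anisotropic h1 /\ anisotropic h2.
Proof.
move=> a; split=> x x0.
  have := a (row_mx x 0); rewrite /= /osum_val !row_mxKl !row_mxKr x0 hval0l addr0.
  by move/(_ erefl)/(congr1 lsubmx); rewrite row_mxKl => ->; rewrite raddf0.
have := a (row_mx 0 x); rewrite /= /osum_val !row_mxKl !row_mxKr x0 hval0l addr0.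
by move/(_ erefl)/(congr1 rsubmx); rewrite row_mxKr => ->; rewrite raddf0.
Qed.

Lemma hdim0_isometric h : hdim h = 0 -> isometric h (hzero eps rho).
Proof.
case: h => n g Dl Zl C N /= n0; subst n.
apply: (@isometricI _ _ _ (HForm Dl Zl C N) (hzero eps rho) id id) => //= x y.
have -> : x = 0 by apply/rowP => -[].
exact: esym (@hval0l (HForm Dl Zl C N) y).
Qed.

Lemma metabolic_anisotropic_dim h : metabolic h -> anisotropic h -> hdim h = 0.
Proof.
case=> L LP a.
have L0 x : L x -> x = 0 by move=> Lx; apply: a; apply: (proj1 (LP x) Lx).
have Lall (x : 'rV[E]_(hdim h)) : x = 0.
  by apply: (L0 x); apply: (proj2 (LP x)) => y /L0 ->; rewrite hval0r.
case: (hdim h) Lall => // n Lall.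
have := Lall (const_mx 1) => /rowP/(_ 0); rewrite !mxE => /eqP.
by rewrite oner_eq0.
Qed.

End FormBasics.

Section DiagonalBasics.
Variables (E : unitRingType) (eps : bool) (rho : involution E).
Local Notation form := (hform eps rho).
Local Notation ok := (diag_ok eps rho).

Lemma diag_form_congr (u w : seq E) (uP : ok u) (wP : ok w) : u = w ->
  diag_form uP = diag_form wP.
Proof. by move=> e; case: w / e wP => wP; rewrite (bool_irrelevance uP wP). Qed.

Lemma diag_nil (nP : ok [::]) : isometric (diag_form nP) (hzero eps rho).
Proof. exact: hdim0_isometric. Qed.

Lemma diag_cons c u (cuP : ok (c :: u)) (cP : ok [:: c]) (uP : ok u) :
  isometric (diag_form cuP) (osum (diag_form cP) (diag_form uP)).
Proof.
apply: (@isometricI _ _ _ (diag_form cuP) (osum (diag_form cP) (diag_form uP))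
          id id) => // x y.
rewrite /= /osum_val /= /diag_val /= [RHS]big_ord_recl big_ord1 !mxE /=.
congr (x 0 _ * _ * rho (y 0 _) + _); try exact: val_inj.
by apply: eq_bigr => i _; rewrite !mxE; congr (x 0 _ * _ * rho (y 0 _));
  apply: val_inj.
Qed.

Lemma diag_ok_cons c u : ok (c :: u) = ok [:: c] && ok u.
Proof. by rewrite /= andbT. Qed.

Lemma diag_ok_consP c u : ok (c :: u) -> ok [:: c] /\ ok u.
Proof. by rewrite diag_ok_cons => /andP. Qed.

Lemma diag_ok_cat u w : ok (u ++ w) = ok u && ok w.
Proof. exact: all_cat. Qed.

Lemma diag_cat u w (uwP : ok (u ++ w)) (uP : ok u) (wP : ok w) :
  isometric (diag_form uwP) (osum (diag_form uP) (diag_form wP)).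
Proof.
elim: u uwP uP => [|c u IH] uwP uP.
  rewrite (diag_form_congr uwP wP) //; apply: isometric_sym.
  apply: (isometric_trans _ (osum0h _)); apply: osum_isometric.
    exact: diag_nil.
  exact: isometric_refl.
have [cP uP'] := diag_ok_consP uP.
have [_ uwP'] := diag_ok_consP uwP.
apply: (isometric_trans (diag_cons uwP cP uwP')).
apply: (isometric_trans (osum_isometric (isometric_refl _) (IH uwP' uP'))).
apply: (isometric_trans (osumA _ _ _)); apply: osum_isometric.
  exact: isometric_sym (diag_cons _ _ _).
exact: isometric_refl.
Qed.

Lemma diag_scale1 c t (cP : ok [:: c]) (tP : ok [:: t * c * rho t]) :
  t \is a GRing.unit -> isometric (diag_form cP) (diag_form tP).
Proof.
move=> ut; apply: (@isometricI _ _ _ (diag_form cP) (diag_form tP)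
  (fun x => map_mx (fun s => s * t^-1) x) (fun x => map_mx (fun s => s * t) x)).
- by move=> s x y; apply/rowP => i; rewrite !mxE mulrDl mulrA.
- by move=> x; apply/rowP => i; rewrite !mxE mulrVK.
- by move=> x; apply/rowP => i; rewrite !mxE mulrK.
move=> x y; rewrite /= /diag_val /= !big_ord1 !mxE /=.
rewrite !mulrA mulrVK // -mulrA; congr (_ * _).
by rewrite -involM mulrVK.
Qed.

Lemma diag_opp_ok u : ok u -> ok [seq - c | c <- u].
Proof.
move/allP=> uP; rewrite /diag_ok all_map; apply/allP => c /uP /=.
by rewrite involN mulrN eqr_opp unitrN.
Qed.

Lemma diag_opp u (uP : ok u) (nP : ok [seq - c | c <- u]) :
  isometric (hopp (diag_form uP)) (diag_form nP).
Proof.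
elim: u uP nP => [|c u IH] uP nP.
  exact: (isometric_trans (hdim0_isometric _) (isometric_sym (diag_nil _))).
have [cP uP'] := diag_ok_consP uP.
have [cN uN] := diag_ok_consP nP.
apply: (isometric_trans (hopp_isometric (diag_cons uP cP uP'))).
apply: (isometric_trans (hopp_osum _ _)).
apply: (isometric_trans _ (isometric_sym (diag_cons nP cN uN))).
apply: osum_isometric; last exact: IH.
apply: (@isometricI _ _ _ (hopp (diag_form cP)) (diag_form cN) id id) => // x y.
by rewrite /= /diag_val /= !big_ord1 /= mulrN mulNr.
Qed.

End DiagonalBasics.

Section DiagonalMap.
Variables (E E' : unitRingType) (eps eps' : bool).
Variables (rho : involution E) (rho' : involution E') (g : E -> E') (u : seq E).
Variable gP : diag_ok eps' rho' [seq g c | c <- u].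

Definition row_up (T : Type) : 'rV[T]_(size u) -> 'rV[T]_(size [seq g c | c <- u]) :=
  castmx (erefl 1%N, esym (size_map g u)).
Definition row_down (T : Type) : 'rV[T]_(size [seq g c | c <- u]) -> 'rV[T]_(size u) :=
  castmx (erefl 1%N, size_map g u).

Lemma row_upK T : cancel (@row_up T) (@row_down T).
Proof. exact: (castmxKV (erefl 1%N) (size_map g u)). Qed.

Lemma row_downK T : cancel (@row_down T) (@row_up T).
Proof. exact: (castmxK (erefl 1%N) (size_map g u)). Qed.

(** The rows of the form <g u_1, ..., g u_r> are indexed by the size of the mapped
    list; transporting them along [row_down] lets the sum run over the indices of
    u itself. *)
Lemma diag_mapE x y : diag_form gP x y =
  \sum_(i < size u) row_down x 0 i * g (u`_i) * rho' (row_down y 0 i).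
Proof.
rewrite /= /diag_val (reindex (cast_ord (esym (size_map g u)))) /=; last first.
  exists (cast_ord (size_map g u)) => i _; first exact: cast_ordKV.
  exact: cast_ordK.
apply: eq_bigr => i _; rewrite /row_down !castmxE /= !cast_ord_id.
by rewrite (nth_map 0).
Qed.

End DiagonalMap.

(** * Diagonalization, anisotropic representatives and separation *)

Section DivisionForms.
Variables (E : unitRingType) (rho : involution E).
Hypotheses (Ediv : division_ring E) (E2 : 2%:R != 0 :> E).
Local Notation form := (hform false rho).
Implicit Types h : form.

Lemma hvalC0 h x y : h y x = rho (h x y).
Proof. by rewrite hvalC expr0 mul1r. Qed.

(** The orthogonal complement of x needs coordinates, since forms live on row
    vectors.  If x_i is nonzero, the projections of the e_j with j <> i along x
    form a basis of it.  The last clause records that vectors orthogonal to x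
    survive in the complement, so that a second vector can be split off. *)
Lemma split_off h x : h x x != 0 ->
  exists (cP : diag_ok false rho [:: h x x]) (h' : form),
    [/\ hdim h = (hdim h').+1, isometric h (osum (diag_form cP) h')
      & forall y, h y x = 0 -> exists y', h' y' y' = h y y].
Proof.
move=> dn0; have ud := Ediv dn0; set d := h x x in dn0 ud *.
have rd : rho d = d by rewrite /d -hvalC0.
have xn0 : x != 0 by apply: contraNneq dn0 => x0; rewrite /d x0 hval0l.
have [i xi] : exists i, x 0 i != 0.
  apply/existsP; rewrite -negb_forall; apply: contra xn0 => /forallP x0.
  by apply/eqP/rowP => i; rewrite mxE; apply/eqP.
have uxi := Ediv xi.
case: h x @d dn0 ud rd xn0 i xi uxi => -[|n] g gDl gZl gC gN x d dn0 ud rd xn0.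
  by case.
pose h := HForm gDl gZl gC gN; rewrite /= in x d dn0 ud rd xn0 * => i xi uxi.
pose io (w : 'rV[E]_n) : 'rV[E]_n.+1 := \row_j oapp (fun l => w 0 l) 0 (unlift i j).
pose pr (y : 'rV[E]_n.+1) := y - (h y x * d^-1) *: x.
pose de (z : 'rV[E]_n.+1) := \row_l (z - (z 0 i * (x 0 i)^-1) *: x) 0 (lift i l).
have ioP c w w' : io (c *: w + w') = c *: io w + io w'.
  by apply/rowP => j; rewrite !mxE; case: unlift => [l|] /=; rewrite ?mxE // mulr0 addr0.
have prP c y y' : pr (c *: y + y') = c *: pr y + pr y'.
  rewrite /pr hvalDl hvalZl mulrDl scalerDl opprD scalerBr scalerA mulrA.
  by rewrite addrACA.
have prx y : h (pr y) x = 0.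
  by rewrite /pr hvalBl hvalZl -/d -[_ * d]/(h y x / d * d) mulrVK // subrr.
have deK w : de (pr (io w)) = w.
  apply/rowP => l; rewrite !mxE /= unlift_none /= liftK /= sub0r.
  by rewrite mulNr mulrK // mulNr opprK subrK.
have ioK z : h z x = 0 -> pr (io (de z)) = z.
  move=> zx.
  have -> : io (de z) = z - (z 0 i * (x 0 i)^-1) *: x.
    apply/rowP => j; rewrite !mxE; case: unliftP => [l ->|->] /=; rewrite ?mxE //.
    by rewrite mulrVK // subrr.
  rewrite /pr hvalBl zx sub0r hvalZl -/d.
  by rewrite mulNr mulrK // scaleNr opprK subrK.
pose g' (w w' : 'rV[E]_n) := h (pr (io w)) (pr (io w')).
have g'Dl w w' z : g' (w + w') z = g' w z + g' w' z.
  by rewrite /g' -[w]scale1r ioP prP !scale1r hvalDl.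
have g'Zl c w z : g' (c *: w) z = c * g' w z.
  have e0 : pr (io 0) = 0.
    have := prP (-1) (io 0) (io 0); rewrite -ioP scaleN1r addNr => ->.
    by rewrite scaleN1r addNr.
  by rewrite /g' -[c *: w]addr0 ioP prP e0 addr0 hvalZl.
have g'C w w' : g' w' w = (-1) ^+ false * rho (g' w w') by rewrite /g' hvalC.
have split_y y : y = (h y x * d^-1) *: x + pr y by rewrite /pr addrC subrK.
have g'N w : (forall w', g' w w' = 0) -> w = 0.
  move=> w0; rewrite -[w]deK.
  have -> : pr (io w) = 0.
    apply: (@hval_nondeg _ _ _ h) => y; rewrite [y]split_y hvalDr hvalZr prx mul0r add0r.
    by rewrite -[pr y]ioK //; apply: w0.
  by apply/rowP => l; rewrite !mxE mul0r mul0r subrr.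
pose h' := HForm g'Dl g'Zl g'C g'N.
have cP : diag_ok false rho [:: h x x].
  by rewrite /diag_ok /= -[g x x]/d ud rd mul1r eqxx.
exists cP, h'; split=> //.
  apply: isometric_sym.
  pose f (t : 'rV[E]_(hdim (osum (diag_form cP) h'))) :=
    lsubmx (t : 'rV_(1 + n)) 0 0 *: x + pr (io (rsubmx (t : 'rV_(1 + n)))).
  pose f' (y : 'rV[E]_n.+1) : 'rV[E]_(hdim (osum (diag_form cP) h')) :=
    row_mx (h y x * d^-1)%:M (de (pr y)) : 'rV_(1 + n).
  apply: (@isometricI _ _ _ (osum (diag_form cP) h') h f f'); rewrite /f /f'.
  - move=> c t t'; rewrite !linearP /= ioP prP !mxE scalerDl !scalerDr scalerA.
    by rewrite addrACA.
  - move=> t; rewrite hvalDl prx addr0 hvalZl -[h x x]/d mulrK //.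
    rewrite -[RHS]hsubmxK; congr row_mx; first by rewrite [RHS]mx11_scalar.
    rewrite -[RHS]deK; congr de.
    rewrite {1}/pr hvalDl prx addr0 hvalZl -[h x x]/d mulrK //.
    by rewrite addrC addKr.
  - by move=> y; rewrite row_mxKl row_mxKr mxE eqxx mulr1n ioK // -split_y.
  - move=> t t'; rewrite [RHS]/= /osum_val [RHS]/= /diag_val [RHS]/= big_ord1 /g'.
    move: (prx (io (rsubmx t))) (prx (io (rsubmx t'))).
    move: (pr (io (rsubmx t))) (pr (io (rsubmx t'))) => p p' px p'x.
    rewrite hvalDl !hvalDr !hvalZl !hvalZr px (hval_sym0 p'x).
    by rewrite mulr0 mul0r addr0 add0r mulrA.
move=> y yx; exists (de y); rewrite /= /g' ioK //.
Qed.

(** If h(u, y) = 1 and all vectors were isotropic, then h(u + y, u + y) = 2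
    would be zero. *)
Lemma exists_nonisotropic h : hdim h != 0 -> exists x, h x x != 0.
Proof.
move=> n0; have [x xn0] : exists x : 'rV[E]_(hdim h), x != 0.
  case: (hdim h) n0 => // n _; exists (const_mx 1); apply/eqP => /rowP/(_ 0).
  by rewrite !mxE => /eqP; rewrite oner_eq0.
have [y hxy] : exists y, h x y != 0.
  apply: contrapT => no; move/eqP: xn0; apply; apply: (@hval_nondeg _ _ _ h) => y.
  by apply/eqP; apply: contraT => ny; case: no; exists y.
pose u := (h x y)^-1 *: x.
have uy : h u y = 1 by rewrite hvalZl mulVr // Ediv.
have yu : h y u = 1 by rewrite hvalC0 uy invol1.
apply: contrapT => no.
have iso z : h z z = 0.
  by apply/eqP; apply: contraT => nz; case: no; exists z.
have := iso (u + y); rewrite hvalDl !hvalDr !iso uy yu add0r addr0 => /eqP.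
by rewrite -(natrD _ 1 1) (negPf E2).
Qed.

Lemma diagonalizable h :
  exists (u : seq E) (uP : diag_ok false rho u), isometric h (diag_form uP).
Proof.
move: {2}(hdim h) (erefl (hdim h)) => n; elim: n h => [|n IH] h hn.
  exists [::], isT; apply: (isometric_trans (hdim0_isometric hn)).
  exact/isometric_sym/hdim0_isometric.
have [|x hx] := @exists_nonisotropic h; first by rewrite hn.
have [cP [h' [hn' i1 _]]] := split_off hx.
have [|u [uP i2]] := IH h'; first by apply/eqP; rewrite -eqSS -hn' hn.
have cuP : diag_ok false rho (h x x :: u) by rewrite diag_ok_cons cP uP.
exists (h x x :: u), cuP; apply: (isometric_trans i1).
apply: (isometric_trans (osum_isometric (isometric_refl _) i2)).
exact/isometric_sym/diag_cons.
Qed.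

Lemma witt_classN h : witt_class (hopp h) = - witt_class h.
Proof. exact: esym (witt_oppE h). Qed.

Lemma witt_class_isometric h1 h2 : isometric h1 h2 -> witt_class h1 = witt_class h2.
Proof. by move=> i; apply/witt_class_eq/isometric_equiv. Qed.

Lemma witt_class_metabolic h : metabolic h -> witt_class h = 0.
Proof. by move=> m; apply/witt_class_eq/metabolic_equiv0. Qed.

Lemma witt_diag_opp u (uP : diag_ok false rho u)
    (nP : diag_ok false rho [seq - c | c <- u]) :
  witt_class (diag_form nP) = - witt_class (diag_form uP).
Proof. by rewrite -witt_classN; apply/esym/witt_class_isometric/diag_opp. Qed.

(** Scale x to w with h(w, y) = 1.  Adding multiples of w to y produces vectors
    of values 1 and -1, and these two are orthogonal; so <1> _|_ <-1>, which is
    zero in the Witt group, splits off. *)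
Lemma split_hyperbolic h x : h x x = 0 -> x != 0 ->
  exists h', (hdim h' < hdim h)%N /\ witt_class h' = witt_class h.
Proof.
move=> xx xn0; have u2 : (2%:R : E) \is a GRing.unit by exact: Ediv.
have [y hxy] : exists y, h x y != 0.
  apply: contrapT => no; move/eqP: xn0; apply; apply: (@hval_nondeg _ _ _ h) => y.
  by apply/eqP; apply: contraT => ny; case: no; exists y.
have [w [ww wy]] : exists w, h w w = 0 /\ h w y = 1.
  exists ((h x y)^-1 *: x).
  by rewrite !hvalZl hvalZr xx mul0r mulr0 mulVr // Ediv.
have yw : h y w = 1 by rewrite hvalC0 wy invol1.
pose z (s : E) := y + ((s - h y y) / 2%:R) *: w.
have rho2 : rho (2%:R^-1) = 2%:R^-1.
  have r2 : rho 2%:R = 2%:R by rewrite (natrD _ 1 1) involD invol1.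
  apply: (mulIr u2); rewrite mulVr // -{2}r2 -involM mulrV // invol1 //.
have rhoz s : rho s = s -> rho ((s - h y y) / 2%:R) = (s - h y y) / 2%:R.
  move=> rs; rewrite involM rho2 involD involN rs -hvalC0.
  by rewrite -[LHS]/(2%:R^-1 * _) -(commrV (commr_nat _ 2)).
have zz s t : rho t = t -> h (z s) (z t) = (s + t) / 2%:R.
  move=> rt; rewrite /z hvalDl !hvalDr !hvalZl !hvalZr ww wy yw rhoz //.
  rewrite mul0r mulr0 addr0 mul1r mulr1.
  rewrite -[X in X + _ + _](mulrK u2) mulr_natr mulr2n -!mulrDl; congr (_ / _).
  by rewrite -addrA addrACA ![h y y + _]addrC !subrK addrC.
have n1 : rho (-1) = -1 by rewrite involN invol1.
have z1 : h (z 1) (z 1) = 1 by rewrite zz ?invol1 // mulrV.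
have z2 : h (z (-1)) (z (-1)) = -1 by rewrite zz // -opprD mulNr mulrV.
have z12 : h (z (-1)) (z 1) = 0 by rewrite zz ?invol1 // addNr mul0r.
have [|c1 [h1 [d1 i1 orth]]] := @split_off h (z 1); first by rewrite z1 oner_neq0.
have [y2 hy2] := orth _ z12.
have [|c2 [h2 [d2 i2 _]]] := @split_off h1 y2.
  by rewrite hy2 z2 oppr_eq0 oner_neq0.
exists h2; split; first by rewrite d1 d2 ltnS leqnSn.
rewrite (witt_class_isometric i1) witt_classD (witt_class_isometric i2) witt_classD.
have o1 : diag_ok false rho [:: 1] by rewrite /= unitr1 invol1 mulr1 eqxx.
have o2 : diag_ok false rho [seq - c | c <- [:: 1]] by exact: diag_opp_ok.
have -> : diag_form c1 = diag_form o1 by apply: diag_form_congr; rewrite z1.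
have -> : diag_form c2 = diag_form o2 by apply: diag_form_congr; rewrite hy2 z2.
by rewrite (witt_diag_opp o1) addNKr.
Qed.

Lemma witt_anisotropic h : exists h', anisotropic h' /\ witt_class h' = witt_class h.
Proof.
move: {2}(hdim h) (leqnn (hdim h)) => n; elim: n h => [|n IH] h hn.
  exists h; split=> // x _; move: x; move: hn; rewrite leqn0 => /eqP ->.
  by move=> x; apply/rowP => -[].
have [a|na] := pselect (anisotropic h); first by exists h.
have [x xx xn0] : exists2 x, h x x = 0 & x != 0.
  apply: contrapT => no; apply: na => x xx; apply/eqP; apply: contraT => nx.
  by case: no; exists x.
have [h1 [lt1 e1]] := split_hyperbolic xx xn0.
have [|h2 [a2 e2]] := IH h1; first by rewrite -ltnS (leq_trans lt1).
by exists h2; split=> //; rewrite e2.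
Qed.

(** Subspaces are predicates, as Lagrangians are in [metabolic]. *)
Definition subspace n (W : 'rV[E]_n -> Prop) : Prop :=
  W 0 /\ forall c x y, W x -> W y -> W (c *: x + y).

Lemma subspaceZ n (W : 'rV[E]_n -> Prop) c x : subspace W -> W x -> W (c *: x).
Proof. by case=> W0 WL Wx; rewrite -[_ *: _]addr0; apply: WL. Qed.

Lemma subspaceD n (W : 'rV[E]_n -> Prop) x y : subspace W -> W x -> W y -> W (x + y).
Proof. by case=> W0 WL Wx Wy; rewrite -[x]scale1r; apply: WL. Qed.

(** Gaussian elimination on the first coordinate: subtracting multiples of a vector
    of W whose first coordinate is 1 reduces to vectors with first coordinate 0. *)
Lemma separate_row n (W : 'rV[E]_n -> Prop) x : subspace W -> ~ W x ->
  exists c : 'cV[E]_n, (forall w, W w -> w *m c = 0) /\ x *m c != 0.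
Proof.
elim: n W x => [|n IH] W x sW nWx.
  by case: nWx; have -> : x = 0 by [apply/rowP => -[]]; case: sW.
move: W x sW nWx; rewrite -[n.+1]/(1 + n)%N => W x sW nWx.
pose W' (w : 'rV[E]_n) := W (row_mx 0 w : 'rV_(1 + n)).
have sW' : subspace W'.
  split; first by rewrite /W' row_mx0; case: sW.
  move=> c w w' Ww Ww'; rewrite /W'.
  have -> : row_mx 0 (c *: w + w') = c *: row_mx 0 w + row_mx 0 w' :> 'rV_(1 + n).
    by rewrite scale_row_mx add_row_mx scaler0 addr0.
  exact: sW.2.
have tailE (w : 'rV[E]_(1 + n)) : w 0 0 = 0 -> w = row_mx 0 (rsubmx w).
  move=> w0; rewrite -[LHS]hsubmxK; congr row_mx.
  by apply/rowP => i; rewrite ord1 !mxE -[RHS]w0; congr (w _ _); apply: val_inj.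
have [[w0 [Ww0 w00]]|no] := pselect (exists w, W w /\ w 0 0 != 0); last first.
  have W0 w : W w -> w 0 0 = 0.
    by move=> Ww; apply/eqP; apply: contraT => nz; case: no; exists w.
  have [x0|x0] := eqVneq (x 0 0) 0.
    have [|c [cW cx]] := IH W' (rsubmx (x : 'rV_(1 + n))) sW'.
      by rewrite /W' -tailE.
    exists (col_mx 0 c : 'cV_(1 + n)); split.
      move=> w Ww; rewrite (tailE _ (W0 w Ww)) mul_row_col mul0mx add0r cW //.
      by rewrite /W' -tailE //; apply: W0.
    by rewrite (tailE _ x0) mul_row_col mul0mx add0r.
  exists (delta_mx 0 0); rewrite -colE; split=> [w Ww|].
    by rewrite -colE; apply/matrixP => i j; rewrite !ord1 !mxE W0.
  by apply: contraNneq x0 => /matrixP/(_ 0 0); rewrite !mxE => ->.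
pose w1 := (w0 0 0)^-1 *: w0.
have Ww1 : W w1 by apply: subspaceZ.
have w10 : w1 0 0 = 1 by rewrite mxE mulVr // Ediv.
pose r (y : 'rV[E]_(1 + n)) : 'rV[E]_(1 + n) := y - y 0 0 *: w1.
have r0 y : r y 0 0 = 0 by rewrite !mxE -[w0 0 0]/(w0 0 0) mulVr ?Ediv // mulr1 subrr.
have [|c [cW cx]] := IH W' (rsubmx (r x)) sW'.
  rewrite /W' -tailE // => Wr; apply: nWx.
  by rewrite -[x](subrK (x 0 0 *: w1)); apply: subspaceD => //; apply: subspaceZ.
pose c1 : 'cV[E]_(1 + n) := col_mx (- (rsubmx (w1 : 'rV_(1 + n)) *m c)) c.
have c1w : (w1 : 'rV_(1 + n)) *m c1 = 0.
  rewrite -[X in X *m _](@hsubmxK _ 1 1 n) mul_row_col mulmxN.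
  have -> : lsubmx (w1 : 'rV_(1 + n)) = 1%:M.
    apply/matrixP => i j; rewrite !ord1 [LHS]mxE [RHS]mxE /= -[RHS]w10; congr (w1 _ _).
    exact: val_inj.
  by rewrite mul1mx addNr.
have c1r y : y *m c1 = rsubmx (r y) *m c.
  rewrite -[y in LHS](subrK (y 0 0 *: w1)) mulmxDl -scalemxAl c1w scaler0 addr0.
  by rewrite -/(r y) {1}(tailE _ (r0 y)) mul_row_col mul0mx add0r.
exists c1; split=> [w Ww|]; rewrite c1r // cW // /W' -tailE //.
by rewrite /r -scaleNr; apply: subspaceD => //; apply: subspaceZ.
Qed.

(** The double orthogonal of a subspace is the subspace itself.  Every linear
    functional has the form h(-, y), as one sees on a diagonal form. *)
Lemma separate_form h (W : 'rV[E]_(hdim h) -> Prop) x : subspace W -> ~ W x ->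
  exists y, (forall w, W w -> h w y = 0) /\ h x y != 0.
Proof.
move=> sW nWx; have [u [uP [f [[g fK gK] fh]]]] := diagonalizable h.
have gP : linear g by move=> c s t; apply: (can_inj fK); rewrite linearP !gK.
pose W' (t : 'rV[E]_(size u)) := W (g t).
have sW' : subspace W'.
  split; rewrite /W'.
    have -> : g 0 = 0 by apply: (can_inj fK); rewrite gK raddf0.
    by case: sW.
  by move=> c s t Ws Wt; rewrite gP; apply: sW.2.
have [|c [cW cx]] := separate_row (x := f x) sW'; first by rewrite /W' fK.
pose y : 'rV[E]_(size u) := \row_(i < size u) rho ((u`_i)^-1 * c i 0).
have yE s : diag_form uP s y = (s *m c) 0 0.
  rewrite /= /diag_val mxE; apply: eq_bigr => i _; rewrite mxE involK -mulrA.
  by rewrite mulVKr // ; have /andP[] := elimT (all_nthP 0) uP i (ltn_ord i).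
exists (g y); split=> [w Ww|]; rewrite -fh gK yE.
  by rewrite cW ?mxE // /W' fK.
by apply: contraNneq cx => c0; apply/eqP/matrixP => i j; rewrite !ord1 [RHS]mxE.
Qed.

Lemma metabolic_subspace h L : (forall x, L x <-> (forall y, L y -> h x y = 0)) ->
  subspace L.
Proof.
move=> LP; split; first by apply/LP => y _; rewrite hval0l.
move=> c x y Lx Ly; apply/LP => z Lz; rewrite hvalDl hvalZl.
by rewrite (proj1 (LP x) Lx) // (proj1 (LP y) Ly) // mulr0 addr0.
Qed.

(** Symplectic reduction.  For Lagrangians L1 of m and L2 of h _|_ m, the vectors
    x of h with (x, y) in L2 for some y in L1 form a Lagrangian of h.  If x is
    orthogonal to all of these, then (x, 0) is orthogonal to the orthogonal of
    L2 + (0, L1), hence lies in that sum, and so x is one of these vectors. *)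
Lemma metabolic_cancel h m : metabolic m -> metabolic (osum h m) -> metabolic h.
Proof.
move=> [L1 L1P] [L2 L2P]; have sL1 := metabolic_subspace L1P.
have sL2 := metabolic_subspace L2P.
pose rw x y : 'rV[E]_(hdim (osum h m)) := row_mx x y : 'rV_(hdim h + hdim m).
have rwE x y x' y' : osum h m (rw x y) (rw x' y') = h x x' + m y y'.
  by rewrite /= /osum_val !row_mxKl !row_mxKr.
have rwD c x y x' y' : rw (c *: x + x') (c *: y + y') = c *: rw x y + rw x' y'.
  by rewrite /rw -add_row_mx -scale_row_mx.
exists (fun x => exists2 y, L1 y & L2 (rw x y)) => x; split.
  move=> [y Ly Lxy] x' [y' Ly' Lxy'].
  have := proj1 (L2P _) Lxy _ Lxy'; rewrite rwE (proj1 (L1P _) Ly _ Ly') addr0.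
  exact.
move=> xL.
pose W t := exists s y, [/\ L2 s, L1 y & t = s + rw 0 y].
have sW : subspace W.
  split.
    exists 0, 0; split; [by case: sL2 | by case: sL1 |].
    by rewrite add0r /rw row_mx0.
  move=> c t t' [s [y [Ls Ly ->]]] [s' [y' [Ls' Ly' ->]]].
  exists (c *: s + s'), (c *: y + y'); split; [exact: sL2.2|exact: sL1.2|].
  have -> : rw 0 (c *: y + y') = c *: rw 0 y + rw 0 y'.
    by rewrite -rwD scaler0 addr0.
  by rewrite scalerDr addrACA.
have [[s [y [Ls Ly e]]]|nW] := pselect (W (rw x 0)).
  exists (- y); first by rewrite -scaleN1r; apply: subspaceZ.
  have -> : rw x (- y) = s; last by [].
  rewrite -[s](addrK (rw 0 y)) -e -[- rw 0 y]scaleN1r addrC -rwD.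
  by rewrite scaler0 add0r scaleN1r addr0.
have [t [tW]] := separate_form sW nW.
pose t1 := lsubmx (t : 'rV_(hdim h + hdim m)).
pose t2 := rsubmx (t : 'rV_(hdim h + hdim m)).
have tE : t = rw t1 t2 by rewrite /rw hsubmxK.
have Lt : L2 t.
  apply/L2P => s Ls; apply: hval_sym0; apply: tW.
  exists s, 0; split=> //; first by case: sL1.
  by rewrite /rw row_mx0 addr0.
have Lt2 : L1 t2.
  apply/L1P => y Ly; apply: hval_sym0.
  have := tW (rw 0 y); rewrite tE rwE hval0l add0r; apply.
  exists 0, y; split=> //; first by case: sL2.
  by rewrite add0r.
rewrite tE rwE hval0l addr0 xL ?eqxx //.
by exists t2 => //; rewrite -tE.
Qed.

Lemma witt0_metabolic h : witt_class h = 0 -> metabolic h.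
Proof.
move=> h0.
have /eqP/witt_classP[m1 [m2 [M1 M2 i]]] : witt_class h = witt_class (hzero false rho).
  by [].
apply: (metabolic_cancel M1); apply: (isometric_metabolic _ M2).
exact: isometric_trans (isometric_sym (osum0h _)) (isometric_sym i).
Qed.

Lemma anisotropic_witt0 h : anisotropic h -> witt_class h = 0 -> hdim h = 0.
Proof. by move=> a /witt0_metabolic/metabolic_anisotropic_dim; apply. Qed.

End DivisionForms.

(** * Integral linear functionals *)

Section IntegralFunctionals.
Variables (E : unitRingType) (O : {pred E}).
Hypotheses (Ediv : division_ring E) (Osub : subring_closed O).
Hypothesis Opivot : forall n (w : 'rV[E]_n), w != 0 ->
  exists i, w 0 i != 0 /\ forall j, (w 0 i)^-1 * w 0 j \in O.

(** L cap O^n is a direct summand of O^n, so a functional that is integral on it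
    extends to an integral functional on O^n.  A pivot gives a vector of L with
    integral coordinates, one of which is 1; splitting off the line it spans
    removes an index from the support of L. *)
Lemma integral_functional n (L : 'rV[E]_n -> Prop) (c : 'cV[E]_n) : subspace L ->
  (forall w, L w -> (forall i, w 0 i \in O) -> (w *m c) 0 0 \in O) ->
  exists c' : 'cV[E]_n, (forall i, c' i 0 \in O) /\
    forall w, L w -> w *m c' = w *m c.
Proof.
have [O1 OB OM] := Osub.
have O0 : 0 \in O by rewrite -(subrr 1) OB.
have OD x y : x \in O -> y \in O -> x + y \in O.
  by move=> xO yO; rewrite -[y]opprK OB // -sub0r OB.
move: {2}#|[set: 'I_n]| (leqnn #|[set: 'I_n]|) => m.
have: forall w, L w -> forall i, i \notin [set: 'I_n] -> w 0 i = 0.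
  by move=> w _ i; rewrite inE.
elim: m [set: 'I_n] L => [|m IH] S L supp cS sL Lc.
  have {}cS : S = set0 by apply/eqP; rewrite -cards_eq0 -leqn0.
  exists 0; split=> [i|w Lw]; first by rewrite mxE.
  have -> : w = 0 by apply/rowP => i; rewrite mxE supp // cS inE.
  by rewrite !mul0mx.
have [[w [Lw wn0]]|no] := pselect (exists w, L w /\ w != 0); last first.
  exists 0; split=> [i|w Lw]; first by rewrite mxE.
  have -> : w = 0 by apply/eqP; apply: contraT => wn0; case: no; exists w.
  by rewrite !mul0mx.
have [i [wi wO]] := Opivot wn0.
pose w1 := (w 0 i)^-1 *: w.
have Lw1 : L w1 by apply: subspaceZ.
have w1i : w1 0 i = 1 by rewrite mxE mulVr ?Ediv.
have w1O j : w1 0 j \in O by rewrite mxE.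
pose L' u := L u /\ u 0 i = 0.
have iS : i \in S by apply: contraNT wi => /(supp w Lw) ->.
have [||||c1 [c1O c1E]] := IH (S :\ i) L'.
- move=> u [Lu ui] j; rewrite !inE negb_and negbK => /orP[/eqP -> //|].
  exact: supp.
- by move: cS; rewrite (cardsD1 i) iS.
- split; first by split; [case: sL | rewrite mxE].
  move=> t u u' [Lu ui] [Lu' u'i]; split; first exact: sL.2.
  by rewrite !mxE ui u'i mulr0 addr0.
- by move=> u [Lu _]; apply: Lc.
exists (c1 + delta_mx i 0 *m (w1 *m c - w1 *m c1)); split=> [j|u Lu].
  rewrite mxE OD // mxE big_ord1 mxE eqxx andbT.
  have : (w1 *m c - w1 *m c1) 0 0 \in O.
    rewrite mxE [X in _ + X]mxE; apply: OB; first exact: Lc.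
    by rewrite mxE; elim/big_ind: _ => // l _; apply: OM.
  by case: (j == i); rewrite ?mul1r // mul0r.
have [r uE Lr] : exists2 r : 'rV[E]_n, u = u 0 i *: w1 + r & L' r.
  exists (u - u 0 i *: w1); first by rewrite addrC subrK.
  split; last by rewrite !mxE mulVr ?Ediv // mulr1 subrr.
  by rewrite -scaleNr; apply: subspaceD => //; apply: subspaceZ.
have mulE (t : 'rV[E]_n) (X : 'M[E]_1) :
    t *m (c1 + delta_mx i 0 *m X) = t *m c1 + t 0 i *: X.
  rewrite mulmxDr mulmxA -colE; congr (_ + _); rewrite -mul_scalar_mx.
  by congr (_ *m _); apply/matrixP => p q; rewrite !ord1 !mxE.
have w1c : w1 *m (c1 + delta_mx i 0 *m (w1 *m c - w1 *m c1)) = w1 *m c.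
  by rewrite mulE w1i scale1r addrC subrK.
have L'c (t : 'rV[E]_n) : L' t ->
    t *m (c1 + delta_mx i 0 *m (w1 *m c - w1 *m c1)) = t *m c.
  by case=> Lt ti; rewrite mulE ti scale0r addr0 c1E.
rewrite uE !mulmxDl -!(scalemxAl (u 0 i)) w1c; congr (_ + _).
exact: L'c.
Qed.

End IntegralFunctionals.

(** * Discrete valuations and square roots of principal units *)

Section Valuation.
Variables (K : fieldType) (v : K -> int).
Hypothesis hv : normalized_valuation v.

(** The fractional ideal of elements of valuation at least N.  It contains 0, where
    the value of v means nothing. *)
Definition vge (N : int) : {pred K} := [pred x | (x == 0) || (N <= v x)].

Lemma v1 : v 1 = 0.
Proof. by apply: (addrI (v 1)); rewrite addr0 -(valM hv) ?oner_neq0 // mulr1. Qed.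

Lemma vN x : v (- x) = v x.
Proof.
have n1 : -1 != 0 :> K by rewrite oppr_eq0 oner_neq0.
have vn1 : v (-1) = 0.
  by have := valM hv n1 n1; rewrite mulrNN mulr1 v1; lia.
have [->|xn0] := eqVneq x 0; first by rewrite oppr0.
by rewrite -mulN1r (valM hv) // vn1 add0r.
Qed.

Lemma vV x : x != 0 -> v x^-1 = - v x.
Proof.
by move=> xn0; have := valM hv xn0 (invr_neq0 xn0); rewrite mulfV // v1; lia.
Qed.

Lemma vgeE N x : x != 0 -> (x \in vge N) = (N <= v x).
Proof. by rewrite inE => /negPf ->. Qed.

Lemma vge0 N : 0 \in vge N.
Proof. by rewrite inE eqxx. Qed.

Lemma vge_trans N M x : N <= M -> x \in vge M -> x \in vge N.
Proof. by rewrite !inE => NM /orP[->//|/(le_trans NM) ->]; rewrite orbT. Qed.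

Lemma vgeD N x y : x \in vge N -> y \in vge N -> x + y \in vge N.
Proof.
rewrite !inE => /orP[/eqP->|xN]; first by rewrite add0r.
move=> /orP[/eqP->|yN]; first by rewrite addr0 xN orbT.
have [->|xn0] := eqVneq x 0; first by rewrite add0r yN orbT.
have [->|yn0] := eqVneq y 0; first by rewrite addr0 xN orbT.
have [//|xyn0] := eqVneq (x + y) 0.
by apply: le_trans (valD hv xn0 yn0 xyn0); rewrite le_min xN.
Qed.

Lemma vgeN N x : (- x \in vge N) = (x \in vge N).
Proof. by rewrite !inE oppr_eq0 vN. Qed.

Lemma vgeB N x y : x \in vge N -> y \in vge N -> x - y \in vge N.
Proof. by move=> xN yN; rewrite vgeD // vgeN. Qed.

Lemma vgeM N M x y : x \in vge N -> y \in vge M -> x * y \in vge (N + M).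
Proof.
have [->|xn0] := eqVneq x 0; first by rewrite mul0r => _ _; apply: vge0.
have [->|yn0] := eqVneq y 0; first by rewrite mulr0 => _ _; apply: vge0.
by rewrite !vgeE ?mulf_neq0 // (valM hv) //; lia.
Qed.

Lemma vgeM0 x y : x \in vge 0 -> y \in vge 0 -> x * y \in vge 0.
Proof. exact: vgeM. Qed.

Lemma vge_all x : (forall N, x \in vge N) -> x = 0.
Proof.
move=> xN; apply/eqP; apply: contraT => xn0.
by have := xN (v x + 1); rewrite vgeE // gerDl.
Qed.

Lemma val_closeP N x y : val_close v N x y <-> x - y \in vge N.
Proof.
rewrite inE subr_eq0; split=> [[->|->]|/orP[/eqP|]]; rewrite ?eqxx ?orbT //.
  by left.
by right.
Qed.

Lemma vge_pivot (I : finType) (i0 : I) (f : I -> K) : f i0 != 0 ->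
  exists2 i, f i != 0 & forall j, f j / f i \in vge 0.
Proof.
move=> fi0.
case: (@arg_minP _ _ _ i0 (fun i => f i != 0) (fun i => v (f i)) fi0) => i fi im.
exists i => // j; have [->|fj] := eqVneq (f j) 0; first by rewrite mul0r vge0.
rewrite vgeE ?mulf_neq0 ?invr_neq0 // (valM hv) ?invr_neq0 // vV // subr_ge0.
exact: im.
Qed.

(** The square root is 1 + l, where l is the limit of the iteration
    s |-> (e - s ^+ 2) / 2, a contraction of the maximal ideal. *)
Lemma hensel_sqrt (e : K) : val_complete v -> 2%:R != 0 :> K -> v 2%:R = 0 ->
  e \in vge 1 -> exists t, t ^+ 2 = 1 + e.
Proof.
move=> cpl n2 v2 e1.
have half N x : x \in vge N -> x / 2%:R \in vge N.
  by move=> xN; rewrite -[N]addr0; apply: vgeM => //; rewrite vgeE ?invr_neq0 // vV // v2.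
pose s := fix s n := if n is m.+1 then (e - s m ^+ 2) / 2%:R else 0.
have sE n : s n.+1 = (e - s n ^+ 2) / 2%:R by [].
have s1 n : s n \in vge 1.
  elim: n => [|n IH] /=; first exact: vge0.
  by apply: half; rewrite vgeB // expr2; apply: (@vge_trans _ (1 + 1)) => //; apply: vgeM.
have sS n : s n.+1 - s n \in vge n.+1.
  elim: n => [|n IH]; first by rewrite subr0; apply: s1.
  have -> : s n.+2 - s n.+1 = (- (s n.+1 - s n) * (s n.+1 + s n)) / 2%:R.
    rewrite (sE n.+1) [X in _ - X = _]sE; move: (s n.+1) (s n) => x y.
    by rewrite -mulrBl; congr (_ / _); ring.
  apply: half; apply: (@vge_trans _ (n.+1%:Z + 1)); first by lia.
  by apply: vgeM; rewrite ?vgeN // vgeD.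
have sm n m : s (n + m)%N - s n \in vge n.+1.
  elim: m => [|m IH]; first by rewrite addn0 subrr vge0.
  rewrite addnS -(subrKA (s (n + m)%N)) vgeD //.
  by apply: vge_trans (sS _); lia.
have [N|l lP] := cpl s.
  exists `|N|%N => m n nm nn; apply/val_closeP.
  have sN j : (`|N| <= j)%N -> s j - s `|N|%N \in vge N.
    by move=> /subnKC <-; apply: vge_trans (sm _ _); lia.
  by rewrite -(subrKA (s `|N|%N)) vgeD ?sN // -opprB vgeN sN.
exists (1 + l); apply/eqP; rewrite -subr_eq0; apply/eqP/vge_all => N.
wlog N1 : N / 1 <= N.
  move=> H; apply: (@vge_trans _ (`|N| + 1)); first by lia.
  by apply: H; lia.
have [n0 n0P] := lP N.
have c0 := proj1 (val_closeP _ _ _) (n0P n0 (leqnn _)).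
have c1 := proj1 (val_closeP _ _ _) (n0P n0.+1 (leqnSn _)).
have l1 : l \in vge 1.
  by rewrite -(subKr (s n0) l) vgeB //; apply: vge_trans c0.
have -> : (1 + l) ^+ 2 - (1 + e) = - (s n0 - l) * (l + s n0) - 2%:R * (s n0.+1 - l).
  by rewrite sE; move: (s n0) => x; field.
rewrite vgeB //.
  rewrite -[N]addr0; apply: vgeM; rewrite ?vgeN //.
  by apply: (@vge_trans _ 1) => //; apply: vgeD.
by rewrite -[N]add0r; apply: vgeM => //; rewrite vgeE // v2.
Qed.

End Valuation.

(** * The residue quaternion algebra and the valuation of a quaternion *)

Lemma quat_conj_fixed (F : fieldType) (a b : F) (d : quat a b) : 2%:R != 0 :> F ->
  quat_conj d = d -> d = (qc0 d)%:A.
Proof.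
move=> n2; have z (c : F) : - c = c -> c = 0.
  move=> e; apply/eqP; move/eqP: e; rewrite eq_sym -addr_eq0 -mulr2n -mulr_natl.
  by rewrite mulf_eq0 (negPf n2).
case: d => [c0 c1 c2 c3] [/z -> /z -> /z ->].
by apply: quatP; rewrite /= ?mulr0 ?mulr1.
Qed.

Section Residue.
Variables (K k : fieldType) (v : K -> int) (res : K -> k).
Hypothesis hv : normalized_valuation v.
Hypothesis hres : residue_map (val_ring v) (val_max v) res.
Local Notation vge := (vge v).
Local Notation O := (vge 0).

Lemma res_add x y : x \in O -> y \in O -> res (x + y) = res x + res y.
Proof. exact: (resD hres). Qed.

Lemma res_mul x y : x \in O -> y \in O -> res (x * y) = res x * res y.
Proof. exact: (resM hres). Qed.

Lemma res_eq0 x : x \in O -> (res x == 0) = (x \in vge 1).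
Proof. by move=> xO; apply/eqP/idP => /(res_ker hres xO). Qed.

Lemma res0 : res 0 = 0.
Proof. by apply/eqP; rewrite res_eq0 vge0. Qed.

Lemma res_opp x : x \in O -> res (- x) = - res x.
Proof.
move=> xO; apply: (addrI (res x)); rewrite subrr -res_add ?(vgeN hv) //.
by rewrite subrr res0.
Qed.

Lemma res_unit x : x \in O -> res x != 0 -> x != 0 /\ v x = 0.
Proof.
move=> xO rx; have xn0 : x != 0 by apply: contraNneq rx => ->; rewrite res0.
by split=> //; move: rx (xO); rewrite res_eq0 // !vgeE // -ltNge => *; lia.
Qed.

Lemma val_unitsE x : x \in val_units v -> [/\ x \in O, x != 0, v x = 0 & res x != 0].
Proof.
move=> /andP[xn0 /eqP vx]; have xO : x \in O by rewrite vgeE // vx.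
by split=> //; rewrite res_eq0 // vgeE // vx.
Qed.

Lemma vgeO1 : 1 \in O.
Proof. by rewrite vgeE ?oner_neq0 // (v1 hv). Qed.

Lemma residue_char2 : 2%:R != 0 :> k -> 2%:R != 0 :> K /\ v 2%:R = 0.
Proof.
move=> n2; apply: res_unit; rewrite (natrD _ 1 1) ?(vgeD hv) ?vgeO1 //.
by rewrite res_add ?vgeO1 // (res1 hres) -(natrD _ 1 1).
Qed.

Section Quaternions.
Variables a b : K.
Hypotheses (ha : a \in val_units v) (hb : b \in val_units v).
Local Notation D := (quat a b).
Local Notation Dbar := (quat (res a) (res b)).
Local Notation red := (@quat_red K k res a b).
Local Notation tau := (canonical_involution a b).
Local Notation taubar := (canonical_involution (res a) (res b)).
Local Notation nu := (nuD v).
Implicit Types d e : D.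

(** The lattice of quaternions with coordinates of valuation at least N; by [nu_geE]
    it is also a ball for the valuation of D. *)
Definition qge (N : int) : {pred D} := [pred d |
  [&& qc0 d \in vge N, qc1 d \in vge N, qc2 d \in vge N & qc3 d \in vge N]].

Let aO : a \in O. Proof. by case: (val_unitsE ha). Qed.
Let bO : b \in O. Proof. by case: (val_unitsE hb). Qed.

Local Ltac integral := repeat first
  [assumption | rewrite (vgeN hv) | apply: (vgeD hv) | apply: (vgeM0 hv)].

Lemma qgeE N c0 c1 c2 c3 : (Quat c0 c1 c2 c3 \in qge N) =
  [&& c0 \in vge N, c1 \in vge N, c2 \in vge N & c3 \in vge N].
Proof. by []. Qed.

Lemma qge_trans N M d : N <= M -> d \in qge M -> d \in qge N.
Proof.
move=> NM; case: d => c0 c1 c2 c3; rewrite !qgeE => /and4P[? ? ? ?].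
by apply/and4P; split; apply: vge_trans NM _.
Qed.

Lemma qgeD N d e : d \in qge N -> e \in qge N -> d + e \in qge N.
Proof.
case: d e => [c0 c1 c2 c3] [e0 e1 e2 e3].
rewrite !qgeE => /and4P[? ? ? ?] /and4P[? ? ? ?].
by rewrite inE /=; apply/and4P; split; apply: vgeD.
Qed.

Lemma qgeN N d : d \in qge N -> - d \in qge N.
Proof.
case: d => [c0 c1 c2 c3]; rewrite qgeE => /and4P[? ? ? ?].
by rewrite inE /=; apply/and4P; split; rewrite vgeN.
Qed.

Lemma qge0 N : 0 \in qge N.
Proof. by rewrite qgeE !vge0. Qed.

Lemma qgeB N d e : d \in qge N -> e \in qge N -> d - e \in qge N.
Proof. by move=> dN eN; rewrite qgeD ?qgeN. Qed.

Lemma qge_scale N M c d : c \in vge N -> d \in qge M -> c *: d \in qge (N + M).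
Proof.
case: d => [c0 c1 c2 c3] cN; rewrite qgeE => /and4P[? ? ? ?].
by rewrite inE /=; apply/and4P; split; apply: vgeM.
Qed.

Lemma qgeM N M d e : d \in qge N -> e \in qge M -> d * e \in qge (N + M).
Proof.
case: d e => [c0 c1 c2 c3] [e0 e1 e2 e3].
rewrite !qgeE => /and4P[? ? ? ?] /and4P[? ? ? ?].
have aM x : x \in vge (N + M) -> a * x \in vge (N + M).
  by move=> xN; rewrite -[N + M]add0r vgeM.
have bM x : x \in vge (N + M) -> b * x \in vge (N + M).
  by move=> xN; rewrite -[N + M]add0r vgeM.
rewrite inE /=; apply/and4P; split; rewrite -?mulrA; 
  do ?[apply: vgeB | apply: vgeD | apply: aM | apply: bM | apply: vgeM | done].
Qed.

Lemma qge_conj N d : d \in qge N -> tau d \in qge N.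
Proof. by case: d => [c0 c1 c2 c3]; rewrite !qgeE !vgeN. Qed.

Lemma qge_alg N c : (c%:A \in qge N :> bool) = (c \in vge N).
Proof. by rewrite !inE /= !mulr0 mulr1 !eqxx !andbT. Qed.

Lemma qge_sum N I (r : seq I) (P : pred I) (F : I -> D) :
  (forall i, P i -> F i \in qge N) -> \sum_(i <- r | P i) F i \in qge N.
Proof. by move=> FN; elim/big_ind: _ => //; [exact: qge0 | exact: qgeD]. Qed.

Lemma redD d e : d \in qge 0 -> e \in qge 0 -> red (d + e) = red d + red e.
Proof.
case: d e => [c0 c1 c2 c3] [e0 e1 e2 e3].
rewrite !qgeE => /and4P[? ? ? ?] /and4P[? ? ? ?].
by apply: quatP; rewrite /= res_add.
Qed.

Lemma redM d e : d \in qge 0 -> e \in qge 0 -> red (d * e) = red d * red e.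
Proof.
case: d e => [c0 c1 c2 c3] [e0 e1 e2 e3].
rewrite !qgeE => /and4P[? ? ? ?] /and4P[? ? ? ?].
by apply: quatP; rewrite /= ?(res_add, res_opp, res_mul); integral.
Qed.

Lemma red_conj d : d \in qge 0 -> red (tau d) = taubar (red d).
Proof.
case: d => [c0 c1 c2 c3]; rewrite !qgeE => /and4P[? ? ? ?].
by apply: quatP; rewrite //= res_opp.
Qed.

Lemma red_alg c : red c%:A = (res c)%:A.
Proof. by apply: quatP; rewrite /= ?mulr0 ?mulr1 ?res0. Qed.

Lemma red1 : red 1 = 1.
Proof. by apply: quatP; rewrite /= ?res0 ?(res1 hres). Qed.

Lemma red0 : red 0 = 0.
Proof. by apply: quatP; rewrite /= ?res0. Qed.

Lemma red_eq0 d : d \in qge 0 -> (red d == 0) = (d \in qge 1).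
Proof.
case: d => [c0 c1 c2 c3]; rewrite !qgeE => /and4P[? ? ? ?].
rewrite -!res_eq0 //.
apply/eqP/and4P => [[-> -> -> ->]//|[/eqP e0 /eqP e1 /eqP e2 /eqP e3]].
by apply: quatP.
Qed.

Lemma red_onto (z : Dbar) : exists2 d, d \in qge 0 & red d = z.
Proof.
case: z => z0 z1 z2 z3.
have [c0 ? <-] := res_onto hres z0; have [c1 ? <-] := res_onto hres z1.
have [c2 ? <-] := res_onto hres z2; have [c3 ? <-] := res_onto hres z3.
by exists (Quat c0 c1 c2 c3) => //; apply/and4P; split.
Qed.

Lemma Nrd_int d : d \in qge 0 -> Nrd d \in O.
Proof.
case: d => [c0 c1 c2 c3]; rewrite !qgeE => /and4P[? ? ? ?]; rewrite /Nrd /= !expr2.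
by integral.
Qed.

Lemma res_Nrd d : d \in qge 0 -> res (Nrd d) = Nrd (red d).
Proof.
case: d => [c0 c1 c2 c3]; rewrite !qgeE => /and4P[? ? ? ?]; rewrite /Nrd /= !expr2.
by rewrite ?(res_add, res_opp, res_mul); integral.
Qed.

Lemma Nrd_scale c d : Nrd (c *: d) = c ^+ 2 * Nrd d.
Proof. by rewrite /Nrd /=; ring. Qed.

(** The scalar c is a coordinate of least valuation. *)
Lemma quat_primitive d : d != 0 ->
  exists c d', [/\ c != 0, d = c *: d', d' \in qge 0 & red d' != 0].
Proof.
move=> dn0; pose f (i : 'I_4) := [:: qc0 d; qc1 d; qc2 d; qc3 d]`_i.
have [i0 fi0] : exists i, f i != 0.
  apply/existsP; rewrite -negb_forall; apply: contra dn0 => /forallP f0.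
  have {}f0 i : f i = 0 by apply/eqP.
  by apply/eqP/quatP; [apply: (f0 0)|apply: (f0 1)|apply: (f0 2%:R)|apply: (f0 3%:R)].
have [i fi fP] := vge_pivot hv fi0.
exists (f i), (Quat (qc0 d / f i) (qc1 d / f i) (qc2 d / f i) (qc3 d / f i)).
split=> //; first by apply: quatP => /=; rewrite mulrC divfK.
  by apply/and4P; split;
    [apply: (fP 0) | apply: (fP 1) | apply: (fP 2%:R) | apply: (fP 3%:R)].
apply/eqP => /(congr1 (@quat_tuple _ _ _)) [r0 r1 r2 r3].
have := oner_neq0 k; rewrite -(res1 hres) -(divff fi) => /eqP; apply.
move: fi r0 r1 r2 r3; rewrite /f; move: (i) => [[|[|[|[|//]]]]] //=.
Qed.

Section Division.
Hypothesis hcomplete : val_complete v.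
Hypothesis hchar : 2%:R != 0 :> k.
Hypothesis hD : division_ring D.

Let n2 : 2%:R != 0 :> K. Proof. by case: (residue_char2 hchar). Qed.
Let v2 : v 2%:R = 0. Proof. by case: (residue_char2 hchar). Qed.

Lemma Nrd_neq0 d : d != 0 -> Nrd d != 0.
Proof. exact: hD. Qed.

(** The quotient (c - e) / c is a principal unit, hence a square.  Here c is a unit
    term of a diagonal sum, and e the excess to be removed from that sum. *)
Lemma hensel_quotient (e c : K) : e \in vge 1 -> c \in O -> res c != 0 ->
  exists t, c * t ^+ 2 = c - e.
Proof.
move=> e1 cO rc; have [cn0 vc] := res_unit cO rc.
have [|t tE] := hensel_sqrt hv hcomplete n2 v2 (e := - (e / c)).
  rewrite vgeN // -[1]addr0; apply: vgeM => //.
  by rewrite vgeE ?invr_neq0 // vV // vc.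
by exists t; rewrite tE mulrBr mulr1 mulrCA divff // mulr1.
Qed.

(** A zero of the residue norm form lifts to d with Nrd d in the maximal ideal and
    some unit coordinate; multiplying that coordinate by the square root of
    a principal unit makes the norm vanish exactly, which is impossible in D. *)
Lemma residue_division : division_ring Dbar.
Proof.
move=> z zn0; change (Nrd z != 0); apply: contra zn0 => /eqP Nz.
have [[c0 c1 c2 c3] dO dz] := red_onto z; apply/eqP; rewrite -dz.
have N1 : Nrd (Quat c0 c1 c2 c3 : D) \in vge 1.
  by rewrite -res_eq0 ?Nrd_int // res_Nrd // dz Nz.
have [_ _ _ ra] := val_unitsE ha; have [_ _ _ rb] := val_unitsE hb.
move: dO; rewrite qgeE => /and4P[O0 O1 O2 O3].
set d := Quat c0 c1 c2 c3 in dz N1.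
have rescale c (f : K -> D) : c \in O -> res c != 0 ->
    (forall t, Nrd (f t) = Nrd d - c + c * t ^+ 2) ->
    (forall t, t != 0 -> f t != 0) -> False.
  move=> cO rc Nf fn0; have [t tE] := hensel_quotient N1 cO rc.
  have tn0 : t != 0.
    apply: contraNneq rc => t0; rewrite res_eq0 //; move/eqP: tE.
    by rewrite t0 expr0n mulr0 eq_sym subr_eq0 => /eqP ->.
  have /Nrd_neq0/eqP := fn0 t tn0; apply.
  by rewrite Nf tE addrA subrK subrr.
have neq0 c t : c \in O -> res c != 0 -> t != 0 -> c * t != 0.
  by move=> cO /(res_unit cO)[cn0 _] tn0; rewrite mulf_neq0.
have [r0|r0] := eqVneq (res c0) 0; last first.
  case: (rescale (c0 * c0) (fun t => Quat (c0 * t) c1 c2 c3)).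
  - by integral.
  - by rewrite res_mul // mulf_neq0.
  - by move=> t; rewrite /Nrd /=; ring.
  - by move=> t /(neq0 c0 t O0 r0)/eqP c0t; apply/eqP => -[].
have [r1|r1] := eqVneq (res c1) 0; last first.
  case: (rescale (- (a * (c1 * c1))) (fun t => Quat c0 (c1 * t) c2 c3)).
  - by integral.
  - by rewrite res_opp ?res_mul ?oppr_eq0 ?mulf_neq0 //; integral.
  - by move=> t; rewrite /Nrd /=; ring.
  - by move=> t /(neq0 c1 t O1 r1)/eqP c1t; apply/eqP => -[].
have [r2|r2] := eqVneq (res c2) 0; last first.
  case: (rescale (- (b * (c2 * c2))) (fun t => Quat c0 c1 (c2 * t) c3)).
  - by integral.
  - by rewrite res_opp ?res_mul ?oppr_eq0 ?mulf_neq0 //; integral.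
  - by move=> t; rewrite /Nrd /=; ring.
  - by move=> t /(neq0 c2 t O2 r2)/eqP c2t; apply/eqP => -[].
have [r3|r3] := eqVneq (res c3) 0; last first.
  case: (rescale (a * b * (c3 * c3)) (fun t => Quat c0 c1 c2 (c3 * t))).
  - by integral.
  - by rewrite !res_mul ?mulf_neq0 //; integral.
  - by move=> t; rewrite /Nrd /=; ring.
  - by move=> t /(neq0 c3 t O3 r3)/eqP c3t; apply/eqP => -[].
by apply: quatP.
Qed.

Lemma Nrd_unit d : d \in qge 0 -> red d != 0 ->
  [/\ Nrd d \in O, res (Nrd d) != 0, Nrd d != 0 & v (Nrd d) = 0].
Proof.
move=> dO rd; have rN : res (Nrd d) != 0 by rewrite res_Nrd //; apply: residue_division.
by have [? ?] := res_unit (Nrd_int dO) rN; split=> //; apply: Nrd_int.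
Qed.

(** The residue norm is anisotropic, so a primitive quaternion has unit norm. *)
Lemma nu_scale c d : c != 0 -> d \in qge 0 -> red d != 0 ->
  nu (c *: d) = (v c)%:~R.
Proof.
move=> cn0 dO rd; have [_ _ Nn0 vN] := Nrd_unit dO rd.
rewrite /nuD Nrd_scale (valM hv) ?expf_neq0 // vN addr0 expr2 (valM hv) //.
by rewrite rmorphD /=; field.
Qed.

Lemma nu_int d : d != 0 -> exists N : int, nu d = N%:~R.
Proof.
by move=> /quat_primitive[c [e [cn0 -> eO re]]]; exists (v c); apply: nu_scale.
Qed.

(** Write d = c d' with d' primitive; both sides say that N <= v c.  So the valuation
    of a quaternion is the least valuation of its coordinates. *)
Lemma nu_geE (N : int) d : d != 0 -> (N%:~R <= nu d) = (d \in qge N).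
Proof.
move=> /quat_primitive[c [e [cn0 -> eO re]]]; rewrite nu_scale // ler_int.
apply/idP/idP => [Nv|cN].
  by rewrite -[N]addr0; apply: qge_scale => //; rewrite vgeE.
rewrite leNgt; apply: contra re => vN; rewrite red_eq0 //.
apply: (@qge_trans _ (N - v c)); first lia.
have -> : e = c^-1 *: (c *: e) by rewrite scalerA mulVf // scale1r.
by rewrite addrC; apply: qge_scale => //; rewrite vgeE ?invr_neq0 // vV.
Qed.

Lemma val_ring_nu d : (d \in val_ring nu) = (d \in qge 0).
Proof.
rewrite inE; have [->|dn0] := eqVneq d 0; first by rewrite qge0.
exact: (nu_geE 0 dn0).
Qed.

Lemma val_max_nu d : (d \in val_max nu) = (d \in qge 1).
Proof.
rewrite inE; have [->|dn0] := eqVneq d 0; first by rewrite qge0.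
rewrite -nu_geE //; have [N ->] := nu_int dn0.
by rewrite ltr0z ler1z.
Qed.

Lemma nuM d e : d != 0 -> e != 0 -> nu (d * e) = nu d + nu e.
Proof.
move=> dn0 en0; rewrite /nuD NrdM (valM hv) ?Nrd_neq0 //.
by rewrite rmorphD /= mulrDl.
Qed.

Lemma nu_alg (c : K) : c != 0 -> nu (c%:A : D) = (v c)%:~R.
Proof.
move=> cn0; apply: nu_scale => //.
  by rewrite qgeE vgeO1 !vge0.
by rewrite red1 oner_neq0.
Qed.

Lemma quat_alg_neq0 (c : K) : c != 0 -> (c%:A : D) != 0.
Proof. by move=> cn0; rewrite scaler_eq0 negb_or cn0 oner_neq0. Qed.

Lemma quat_alg_unit (c : K) : c != 0 -> (c%:A : D) \is a GRing.unit.
Proof. by move=> /quat_alg_neq0/hD. Qed.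

Lemma quat_alg_inv (c : K) : c != 0 -> (c%:A : D)^-1 = c^-1%:A.
Proof.
move=> cn0; apply: (mulrI (quat_alg_unit cn0)); rewrite mulrV ?quat_alg_unit //.
by rewrite -scalerAl mul1r scalerA divff // scale1r.
Qed.

Lemma quat_alg_comm (c : K) d : c%:A * d = d * c%:A.
Proof. by rewrite -scalerAl -scalerAr mul1r mulr1. Qed.

Lemma tau_alg (c : K) : tau (c%:A : D) = (c%:A : D).
Proof. by apply: quatP; rewrite /= ?mulr0 ?oppr0. Qed.

Lemma tau_sym d : tau d = d -> d = (qc0 d)%:A.
Proof. exact: quat_conj_fixed. Qed.

(** The value of every nonzero quaternion is an integer, so pi has the least
    positive one; and twisting tau by the central element pi changes nothing. *)
Lemma larmour_setting_quat pi : pi != 0 -> v pi = 1 ->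
  larmour_setting nu false tau pi%:A red taubar taubar.
Proof.
move=> pn0 vpi; split.
- split; [exact: quat_alg_neq0 | by rewrite tau_alg mul1r | |].
    by rewrite nu_alg // vpi.
  move=> d dn0; rewrite nu_alg // vpi; have [N ->] := nu_int dn0.
  by rewrite ltr0z ler_int.
- split.
  + split=> [|d e|d e]; rewrite ?val_ring_nu; first by rewrite qgeE vgeO1 !vge0.
      exact: qgeB.
    exact: (@qgeM 0 0).
  + exact: red1.
  + by move=> d e; rewrite !val_ring_nu; apply: redD.
  + by move=> d e; rewrite !val_ring_nu; apply: redM.
  + move=> d; rewrite val_ring_nu val_max_nu => dO; rewrite -red_eq0 //.
    exact: (rwP eqP).
  + by move=> z; have [d dO <-] := red_onto z; exists d; rewrite ?val_ring_nu.
- move=> d; rewrite !val_ring_nu => dO; split; first exact: qge_conj.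
  exact: red_conj.
- move=> d; rewrite !val_ring_nu => dO.
  rewrite /twist quat_alg_comm mulrK ?quat_alg_unit //.
  by split; [exact: qge_conj | exact: red_conj].
Qed.

(** A coordinate of least valuation is a pivot. *)
Lemma exists_pivot n (w : 'rV[D]_n) : w != 0 ->
  exists i, w 0 i != 0 /\ forall j, (w 0 i)^-1 * w 0 j \in qge 0.
Proof.
move=> wn0; have [i0 wi0] : exists i, w 0 i != 0.
  apply/existsP; rewrite -negb_forall; apply: contra wn0 => /forallP w0.
  by apply/eqP/rowP => i; rewrite mxE; apply/eqP.
case: (@arg_minP _ _ _ i0 (fun i => w 0 i != 0) (fun i => nu (w 0 i)) wi0) => i wi im.
exists i; split=> // j; have [->|wj] := eqVneq (w 0 j) 0; first by rewrite mulr0 qge0.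
have Vi : (w 0 i)^-1 != 0 by rewrite invr_eq0.
have Mn0 : (w 0 i)^-1 * w 0 j != 0.
  apply/eqP => /(congr1 (fun t => w 0 i * t)).
  by rewrite mulVKr ?hD // mulr0; apply/eqP.
rewrite -nu_geE // nuM // -(lerD2l (nu (w 0 i))) addrA -nuM // mulrV ?hD //.
by rewrite addr0 /nuD Nrd1 (v1 hv) mul0r add0r; apply: im.
Qed.


(** * Residue forms of hermitian forms *)

Local Notation ok := (diag_ok false tau).
Local Notation okbar := (diag_ok false taubar).
Local Notation unramified u := ({in u, forall c : D, nu c = 0}).
Local Notation ramified w := ({in w, forall c : D, nu c = 1}).

Lemma diag_okE u c : ok u -> c \in u -> c = (qc0 c)%:A /\ qc0 c != 0.
Proof.
move=> /allP uP /uP /andP[/eqP]; rewrite mul1r => /tau_sym cE cu; split=> //.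
apply: contraTneq cu => c0; rewrite cE c0 scale0r.
by apply/negP => /unitrP[x [/eqP]]; rewrite mulr0 eq_sym oner_eq0.
Qed.

Lemma nu_diagE u (n : int) c : ok u -> c \in u -> nu c = n%:~R ->
  exists2 g : K, c = g%:A & g != 0 /\ v g = n.
Proof.
move=> uP cu; have [cE cn0] := diag_okE uP cu; rewrite cE nu_alg // => /intr_inj vc.
by exists (qc0 c).
Qed.

Lemma unramifiedE u c : ok u -> unramified u -> c \in u ->
  exists g : K, [/\ c = g%:A, g != 0, v g = 0, g \in O & res g != 0].
Proof.
move=> uP u0 cu; have [|g cE [gn0 vg]] := @nu_diagE u 0 c uP cu; first exact: u0.
have [//|gO _ _ rg] := @val_unitsE g; first by rewrite inE gn0 vg eqxx.
by exists g.
Qed.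

Lemma ramifiedE w c : ok w -> ramified w -> c \in w ->
  exists g : K, [/\ c = g%:A, g != 0 & v g = 1].
Proof.
move=> wP w1 cw; have [|g cE [gn0 vg]] := @nu_diagE w 1 c wP cw; first exact: w1.
by exists g.
Qed.

Lemma red_ok u : ok u -> unramified u -> okbar [seq red c | c <- u].
Proof.
move=> uP u0; rewrite /diag_ok all_map; apply/allP => c cu /=.
have [g [-> _ _ _ rg]] := unramifiedE uP u0 cu; rewrite red_alg mul1r.
apply/andP; split; first by apply/eqP/quatP; rewrite /= ?mulr0 ?oppr0.
by apply: residue_division; rewrite scaler_eq0 negb_or rg oner_neq0.
Qed.

Lemma red_sum I (r : seq I) (P : pred I) (F : I -> D) :
  (forall i, P i -> F i \in qge 0) ->
  red (\sum_(i <- r | P i) F i) = \sum_(i <- r | P i) red (F i).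
Proof.
move=> FO; have : red (\sum_(i <- r | P i) F i) = \sum_(i <- r | P i) red (F i)
    /\ \sum_(i <- r | P i) F i \in qge 0.
  elim/big_rec2: _ => [|i y x Pi [IH1 IH2]]; first by rewrite red0 qge0.
  by rewrite redD ?FO // IH1; split=> //; apply: qgeD => //; apply: FO.
by case.
Qed.

Definition integral_row n (x : 'rV[D]_n) := forall i, x 0 i \in qge 0.

Lemma diag_integral (N : int) u (uP : ok u) x y :
  (forall c, c \in u -> c \in qge N) -> integral_row x -> integral_row y ->
  diag_form uP x y \in qge N.
Proof.
move=> uN xO yO; apply: qge_sum => i _; rewrite -[N]add0r -[0 + N]addr0.
apply: qgeM; last exact: qge_conj.
by apply: qgeM => //; apply/uN/mem_nth.
Qed.

(** An integral lift x of the row z; [row_down] only identifies the index types. *)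
Definition row_lifts u (x : 'rV[D]_(size u))
    (z : 'rV[Dbar]_(size [seq red c | c <- u])) :=
  integral_row x /\ forall i, red (x 0 i) = row_down z 0 i.

Lemma row_lift u z : exists x, @row_lifts u x z.
Proof.
have [|f fP] := @boolp.choice _ _
  (fun (i : 'I_(size u)) d => d \in qge 0 /\ red d = row_down z 0 i).
  by move=> i; have [d dO <-] := red_onto (row_down z 0 i); exists d.
exists (\row_i f i); split=> i; rewrite mxE; by case: (fP i).
Qed.

Lemma unramified_int u c : ok u -> unramified u -> c \in u -> c \in qge 0.
Proof.
by move=> uP u0 cu; have [g [-> _ _ gO _]] := unramifiedE uP u0 cu; rewrite qge_alg.
Qed.

Lemma red_diag u (uP : ok u) (ubP : okbar [seq red c | c <- u]) x y z t :
  unramified u -> row_lifts x z -> row_lifts y t ->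
  red (diag_form uP x y) = diag_form ubP z t.
Proof.
move=> u0 [xO xE] [yO yE].
have cO (i : 'I_(size u)) : u`_i \in qge 0.
  by apply: (unramified_int uP u0); apply: mem_nth.
rewrite diag_mapE [X in red X = _]/= /diag_val red_sum => [|i _]; last first.
  by apply: (@qgeM 0 0); [apply: (@qgeM 0 0) | apply: qge_conj].
apply: eq_bigr => i _; rewrite -xE -yE -red_conj // -redM // -redM //.
  2: exact: qge_conj.
exact: (@qgeM 0 0).
Qed.

Lemma integral_functional_quat n (L : 'rV[D]_n -> Prop) (c : 'cV[D]_n) :
  subspace L ->
  (forall w, L w -> integral_row w -> (w *m c) 0 0 \in qge 0) ->
  exists c' : 'cV[D]_n, (forall i, c' i 0 \in qge 0) /\
    forall w, L w -> w *m c' = w *m c.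
Proof.
apply: integral_functional => //; last exact: exists_pivot.
split; first by rewrite qgeE vgeO1 !vge0.
  exact: qgeB.
exact: (@qgeM 0 0).
Qed.

Section Uniformizer.
Variable pi : K.
Hypotheses (pi0 : pi != 0) (vpi : v pi = 1).

(** The u-components of the integral vectors of a Lagrangian L reduce to a
    Lagrangian.  Suppose z is orthogonal to the reduction, and let y lift z.
    Then pi^-1 h(-, y) is integral on the integral vectors of L, and agrees on L
    with the functional of an integral column c'.  That functional is h(-, s), where
    s is integral in the u-components and in pi^-1 O in the w-components.
    Hence y - pi s is an integral vector of L that still lifts z. *)
Lemma metabolic_residue u w (uP : ok u) (wP : ok w)
    (ubP : okbar [seq red c | c <- u]) :
  unramified u -> ramified w ->
  metabolic (osum (diag_form uP) (diag_form wP)) -> metabolic (diag_form ubP).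
Proof.
move=> u0 w1 [L LP]; have sL := metabolic_subspace LP.
set m := osum _ _ in L LP sL *.
have mE x y : m x y =
  diag_form uP (lsubmx x) (lsubmx y) + diag_form wP (rsubmx x) (rsubmx y) by [].
have lO (x : 'rV[D]_(size u + size w)) : integral_row x -> integral_row (lsubmx x).
  by move=> xO i; rewrite mxE.
have rO (x : 'rV[D]_(size u + size w)) : integral_row x -> integral_row (rsubmx x).
  by move=> xO i; rewrite mxE.
have w_int c : c \in w -> c \in qge 1.
  by move=> cw; have [g [-> gn0 vg]] := ramifiedE wP w1 cw; rewrite qge_alg vgeE // vg.
pose L0 z := exists x : 'rV[D]_(size u + size w),
  [/\ L x, integral_row x & row_lifts (lsubmx x) z].
exists L0 => z; split.
  move=> [x [Lx xO xz]] t [y [Ly yO yt]].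
  rewrite -(red_diag uP ubP u0 xz yt); apply/eqP; rewrite red_eq0; last first.
    by apply: diag_integral; [move=> c; apply: unramified_int | apply: lO | apply: lO].
  have /eqP := proj1 (LP x) Lx y Ly; rewrite mE addr_eq0 => /eqP ->.
  by apply: qgeN; apply: diag_integral => //; apply: rO.
move=> zL; have [y yz] := row_lift z.
pose y0 : 'rV[D]_(size u + size w) := row_mx y 0.
have my0 x : m x y0 = diag_form uP (lsubmx x) y.
  by rewrite mE row_mxKl row_mxKr hval0r addr0.
(* the column c represents the functional pi^-1 m(-, y0) *)
pose c : 'cV[D]_(size u + size w) := col_mx (\col_i (pi^-1 *: (u`_i * tau (y 0 i)))) 0.
have cE x : (x *m c) 0 0 = pi^-1 *: m x y0.
  rewrite my0 -[x in LHS]hsubmxK mul_row_col mulmx0 addr0 mxE scaler_sumr.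
  by apply: eq_bigr => i _; rewrite [X in _ * X = _]mxE -scalerAr mulrA.
have [x Lx xO|c' [c'O c'E]] := integral_functional_quat (c := c) sL.
  rewrite cE my0; apply: (@qge_scale (-1) 1).
    by rewrite vgeE ?invr_neq0 // vV // vpi.
  have [z' xz'] : exists z', row_lifts (lsubmx x) z'.
    exists (row_up red (\row_i red (lsubmx x 0 i))); split; first exact: lO.
    by move=> i; rewrite row_upK mxE.
  rewrite -red_eq0; last first.
    apply: diag_integral; [by move=> d; apply: unramified_int | exact: lO |].
    by case: yz.
  rewrite (red_diag uP ubP u0 xz' yz); apply/eqP/hval_sym0/zL.
  by exists x.
(* the vector s represents the functional c': m x s = x *m c' for all x *)
pose s : 'rV[D]_(size u + size w) := row_mx
  (\row_i tau ((u`_i)^-1 * c' (lshift _ i) 0))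
  (\row_j tau ((w`_j)^-1 * c' (rshift _ j) 0)).
have diag_unit (r : seq D) (i : 'I_(size r)) : ok r -> r`_i \is a GRing.unit.
  by move=> rP; have /andP[] := elimT (all_nthP 0) rP i (ltn_ord i).
have ms x : m x s = (x *m c') 0 0.
  rewrite mE row_mxKl row_mxKr mxE big_split_ord /=; congr (_ + _);
  apply: eq_bigr => i _; rewrite !mxE (involK tau) -mulrA mulVKr //; exact: diag_unit.
pose x : 'rV[D]_(size u + size w) := y0 - pi%:A *: s.
have xL : L x.
  apply/LP => t Lt; apply: hval_sym0.
  rewrite hvalDr hvalNr hvalZr ms c'E // cE tau_alg -quat_alg_comm.
  by rewrite -scalerAl mul1r scalerA mulfV // scale1r subrr.
have pi_s (i : 'I_(size u)) : (pi%:A *: s) 0 (lshift _ i) \in qge 1.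
  rewrite mxE row_mxEl mxE; apply: (@qgeM 1 0).
    by rewrite qge_alg vgeE // vpi.
  apply: qge_conj; apply: (@qgeM 0 0) => //.
  have [|g [-> gn0 vg _ _]] := unramifiedE uP u0 (c := u`_i); first exact: mem_nth.
  by rewrite quat_alg_inv // qge_alg vgeE ?invr_neq0 // vV // vg.
have pi_s' (j : 'I_(size w)) : (pi%:A *: s) 0 (rshift _ j) \in qge 0.
  rewrite mxE row_mxEr mxE; apply: (@qgeM 1 (-1)).
    by rewrite qge_alg vgeE // vpi.
  apply: qge_conj; apply: (@qgeM (-1) 0) => //.
  have [|g [-> gn0 vg]] := ramifiedE wP w1 (c := w`_j); first exact: mem_nth.
  by rewrite quat_alg_inv // qge_alg vgeE ?invr_neq0 // vV // vg.
have xl i : lsubmx x 0 i = y 0 i - (pi%:A *: s) 0 (lshift _ i).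
  by rewrite mxE [LHS]mxE row_mxEl; congr (_ + _); rewrite mxE.
have xr i : rsubmx x 0 i = - (pi%:A *: s) 0 (rshift _ i).
  by rewrite mxE [LHS]mxE row_mxEr mxE add0r; rewrite mxE.
have xlO i : lsubmx x 0 i \in qge 0.
  by rewrite xl; apply: qgeB; [case: yz | apply: qge_trans (pi_s i)].
exists x; split=> //; last split=> // i.
  move=> i; rewrite -(splitK i); case: (split i) => j /=.
    by have := xlO j; rewrite mxE.
  by have := xr j; rewrite [LHS]mxE => ->; apply/qgeN/pi_s'.
have [yO yE] := yz; rewrite xl redD ?qgeN //; last first.
  exact: qge_trans (pi_s i).
rewrite yE -[RHS]addr0; congr (_ + _); apply/eqP; rewrite red_eq0.
  exact: qgeN.
by apply: qgeN; apply: qge_trans (pi_s i).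
Qed.

Lemma scale_okE (g : K) u : g != 0 -> ok u -> ok [seq c * g%:A | c <- u].
Proof.
move=> gn0 uP; apply/allP => _ /mapP[c cu ->]; have [cE cn0] := diag_okE uP cu.
have -> : c * g%:A = (qc0 c * g)%:A by rewrite {1}cE -scalerAl mul1r scalerA.
by rewrite mul1r quat_alg_unit ?mulf_neq0 // andbT; apply/eqP/tau_alg.
Qed.

Lemma nu_scale_diag (g : K) u c : g != 0 -> ok u -> c \in u ->
  nu (c * g%:A) = nu c + (v g)%:~R.
Proof.
move=> gn0 uP cu; have [cE cn0] := diag_okE uP cu.
have c0 : c != 0 by rewrite cE; apply: quat_alg_neq0.
have g0 : (g%:A : D) != 0 by apply: quat_alg_neq0.
by rewrite nuM // (nu_alg gn0).
Qed.

Definition unit_part w : seq D := [seq c * (pi^-1)%:A | c <- w].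

Let piV0 : pi^-1 != 0. Proof. by rewrite invr_eq0. Qed.

Lemma unit_part_ok w : ok w -> ok (unit_part w).
Proof. exact: scale_okE. Qed.

Lemma unit_part_unramified w : ok w -> ramified w -> unramified (unit_part w).
Proof.
move=> wP w1 _ /mapP[c cw ->]; rewrite (nu_scale_diag _ wP) // w1 // vV // vpi.
by rewrite rmorphN subrr.
Qed.

(** The form pi^-1 h is <pi^-1 w> _|_ <pi^-1 u>, and the substitution x = pi x'
    changes pi^-1 u into pi u. *)
Lemma metabolic_swap u w (uP : ok u) (wP : ok w)
    (wP' : ok (unit_part w)) (uP' : ok [seq c * pi%:A | c <- u]) :
  metabolic (osum (diag_form uP) (diag_form wP)) ->
  metabolic (osum (diag_form wP') (diag_form uP')).
Proof.
pose t : D := (pi^-1)%:A; have tn0 : t != 0 by apply: quat_alg_neq0.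
have tpi : pi%:A * t = 1 by rewrite -scalerAl mul1r scalerA mulfV // scale1r.
have pit : t * pi%:A = 1 by rewrite -quat_alg_comm.
pose f (x : 'rV[D]_(size u + size w)) :=
  row_mx (row_up (fun c => c * t) (rsubmx x))
         (row_up (fun c => c * pi%:A) (t *: lsubmx x)).
pose g (x : 'rV[D]_(size (unit_part w) + size [seq c * pi%:A | c <- u])) :
    'rV[D]_(size u + size w) :=
  row_mx (pi%:A *: row_down (rsubmx x)) (row_down (lsubmx x)).
apply: (@similar_metabolic _ _ _ (osum (diag_form uP) (diag_form wP))
  (osum (diag_form wP') (diag_form uP')) t f g).
- by move=> d td; rewrite -[d]mul1r -tpi -mulrA td mulr0.
- move=> x; rewrite /f /g row_mxKl row_mxKr !row_upK scalerA tpi scale1r.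
  exact: hsubmxK.
- move=> x; rewrite /f /g row_mxKl row_mxKr scalerA pit scale1r !row_downK.
  exact: hsubmxK.
have E1 (x c y : D) : t * x * (c * pi%:A) * tau (t * y) = t * (x * c * tau y).
  rewrite involM tau_alg -!mulrA -(quat_alg_comm _ (tau y)).
  by rewrite [_ * (t * tau y)]mulrA tpi mul1r.
have E2 (x c y : D) : x * (c * t) * tau y = t * (x * c * tau y).
  by rewrite -(quat_alg_comm _ c) !mulrA -(quat_alg_comm _ x).
have dE r (rP : ok r) x y :
  diag_form rP x y = \sum_(i < size r) x 0 i * r`_i * tau (y 0 i) by [].
have tx n (x : 'rV[D]_n) i : (t *: x) 0 i = t * x 0 i by rewrite mxE.
move=> x y; rewrite -[LHS]/(diag_form wP' (lsubmx (f x)) (lsubmx (f y)) +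
  diag_form uP' (rsubmx (f x)) (rsubmx (f y))).
rewrite /f !row_mxKl !row_mxKr !diag_mapE !row_upK addrC.
rewrite -[osum _ _ x y]/(diag_form uP (lsubmx x) (lsubmx y) +
  diag_form wP (rsubmx x) (rsubmx y)).
rewrite mulrDr !dE !mulr_sumr; congr (_ + _); apply: eq_bigr => i _ //.
by rewrite !tx E1.
Qed.

Lemma metabolic_residues u w (uP : ok u) (wP : ok w)
    (ubP : okbar [seq red c | c <- u]) (wbP : okbar [seq red c | c <- unit_part w]) :
  unramified u -> ramified w ->
  metabolic (osum (diag_form uP) (diag_form wP)) ->
  metabolic (diag_form ubP) /\ metabolic (diag_form wbP).
Proof.
move=> u0 w1 M; split; first exact: (metabolic_residue ubP u0 w1 M).
have uP' := scale_okE pi0 uP.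
apply: (metabolic_residue wbP _ _ (metabolic_swap (unit_part_ok wP) uP' M)).
  exact: unit_part_unramified.
by move=> _ /mapP[c cu ->]; rewrite (nu_scale_diag _ uP) // u0 // vpi add0r.
Qed.

(** A nontrivial zero of the residue form lifts to x with h(x, x) = e in the
    maximal ideal and some x_i of unit norm.  The i-th term u_i Nrd(x_i) is a
    unit, so scaling x_i by a square root of a principal unit lowers the
    sum by e and makes x isotropic. *)
Lemma anisotropic_residue u (uP : ok u) (ubP : okbar [seq red c | c <- u]) :
  unramified u -> anisotropic (diag_form uP) -> anisotropic (diag_form ubP).
Proof.
move=> u0 an z zz; apply/eqP; apply: contraT => zn0.
have [x xz] := row_lift z; have [xO xE] := xz.
have [i zi] : exists i, row_down z 0 i != 0.
  apply/existsP; rewrite -negb_forall; apply: contra zn0 => /forallP z0.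
  rewrite -[z]row_downK; have -> : row_down z = 0.
    by apply/rowP => i; rewrite [RHS]mxE; apply/eqP.
  by apply/eqP/rowP => i; rewrite castmxE !mxE.
pose h := diag_form uP; pose e := qc0 (h x x).
have hE : h x x = e%:A by apply: tau_sym; apply/esym/(hvalC0 (h := h)).
have e1 : e \in vge 1.
  rewrite -qge_alg -hE -red_eq0; last first.
    by apply: diag_integral => // c; apply: unramified_int.
  by rewrite (red_diag uP ubP u0 xz xz) zz.
have [|g [gE gn0 vg gO rg]] := unramifiedE uP u0 (c := u`_i); first exact: mem_nth.
have ri : red (x 0 i) != 0 by rewrite xE.
have [NO rN _ _] := Nrd_unit (xO i) ri.
have cO : g * Nrd (x 0 i) \in O by apply: vgeM0.
have rc : res (g * Nrd (x 0 i)) != 0 by rewrite res_mul // mulf_neq0.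
have [t tE] := hensel_quotient e1 cO rc.
have tn0 : t != 0.
  apply: contraNneq rc => t0; move: tE; rewrite t0 expr0n mulr0 => /esym/eqP.
  by rewrite subr_eq0 => /eqP ->; rewrite res_eq0 // (vge_trans _ e1).
have term (d : D) : d * g%:A * tau d = (g * Nrd d)%:A.
  by rewrite -quat_alg_comm -mulrA NrdE -scalerAl mul1r scalerA.
pose y : 'rV[D]_(size u) := \row_j (if j == i then t *: x 0 i else x 0 j).
have yy : h y y = 0.
  have hx := hE; move: hx; rewrite /h /= /diag_val (bigD1 i) //= gE term => hx.
  rewrite (bigD1 i) //= gE term !mxE eqxx Nrd_scale mulrCA mulrC tE.
  rewrite (eq_bigr (fun j => x 0 j * u`_j * tau (x 0 j))); last first.
    by move=> j ji; rewrite !mxE (negPf ji).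
  by rewrite scalerBl addrAC hx subrr.
have /rowP/(_ i) := an y yy; rewrite !mxE eqxx => /eqP; rewrite scaler_eq0 (negPf tn0) /=.
move=> /eqP x0; by move: zi; rewrite -xE x0 red0 eqxx.
Qed.

Local Notation form := (hform false tau).
Local Notation W := (witt false tau).
Local Notation Wbar := (witt false taubar).

(** A relation instead of a function, since a form has many diagonalizations;
    by [residues_witt] the pair r depends only on the Witt class of h. *)
Definition residues (h : form) (r : Wbar * Wbar) : Prop :=
  exists u w (uP : ok u) (wP : ok w) (ubP : okbar [seq red c | c <- u])
    (wbP : okbar [seq red c | c <- unit_part w]),
    [/\ unramified u, ramified w, isometric h (osum (diag_form uP) (diag_form wP))
      & r = (witt_class (diag_form ubP), witt_class (diag_form wbP))].

Lemma residues_intro h u w (uP : ok u) (wP : ok w) :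
  unramified u -> ramified w -> isometric h (osum (diag_form uP) (diag_form wP)) ->
  exists r, residues h r.
Proof.
move=> u0 w1 i; have ubP := red_ok uP u0.
have wbP := red_ok (unit_part_ok wP) (unit_part_unramified wP w1).
exists (witt_class (diag_form ubP), witt_class (diag_form wbP)).
by exists u, w, uP, wP, ubP, wbP.
Qed.

Lemma scalar_ok (c : K) : c != 0 -> ok [:: c%:A].
Proof.
move=> c0; rewrite /diag_ok /= andbT mul1r quat_alg_unit // andbT.
exact/eqP/tau_alg.
Qed.

(** Replacing an entry g by t g t changes its valuation by an even number, so
    that all valuations become 0 or 1. *)
Lemma exists_decomposition u (uP : ok u) :
  exists s w (sP : ok s) (wP : ok w),
    [/\ unramified s, ramified w
      & isometric (diag_form uP) (osum (diag_form sP) (diag_form wP))].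
Proof.
elim: u uP => [|c u IH] uP.
  exists [::], [::], isT, isT; split=> //; apply: isometric_sym.
  apply: isometric_trans (osum_isometric (diag_nil _) (isometric_refl _)) _.
  apply: isometric_trans (osum0h _) _; rewrite (diag_form_congr _ uP) //.
  exact: isometric_refl.
have [cP uP'] := diag_ok_consP uP; have [s [w [sP [wP [s0 w1 i]]]]] := IH uP'.
have [cE cn0] := diag_okE uP (mem_head _ _); set g := qc0 c in cE cn0.
(* the valuation of g is 2 N + e with e = 0 or 1; multiply g by t ^+ 2, v t = - N *)
have [N [e [vg e01]]] : exists N e : int, v g = N * 2 + e /\ (e = 0 \/ e = 1).
  exists (v g %/ 2)%Z, (v g %% 2)%Z; split; first exact: divz_eq.
  have := modz_ge0 (v g) (isT : 2 != 0 :> int).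
  have := ltz_pmod (v g) (isT : 0 < 2 :> int).
  by move: (v g %% 2)%Z => e; clear; lia.
have [t tn0 vt] := val_onto hv (- N).
have gt0 : g * t ^+ 2 != 0 by rewrite mulf_neq0 ?expf_neq0.
have gP := scalar_ok gt0.
have gE : t%:A * c * tau t%:A = (g * t ^+ 2)%:A.
  have algM (x y : K) : x%:A * y%:A = (x * y)%:A :> D.
    by rewrite -scalerAl mul1r scalerA.
  by rewrite tau_alg cE !algM; congr (_ *: _); rewrite expr2; ring.
have gP' : ok [:: t%:A * c * tau t%:A] by rewrite gE.
have i1 : isometric (diag_form cP) (diag_form gP).
  rewrite -(diag_form_congr gP' gP) ?gE //.
  exact/diag_scale1/quat_alg_unit.
have i2 := isometric_trans (diag_cons uP cP uP') (osum_isometric i1 i).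
have nug : nu ((g * t ^+ 2)%:A : D) = e%:~R.
  rewrite nu_alg // expr2 !(valM hv) ?mulf_neq0 // vt vg; congr (_%:~R).
  by clear; lia.
have [e0|e1] := e01.
  have gsP : ok ((g * t ^+ 2)%:A :: s) by rewrite diag_ok_cons gP.
  exists ((g * t ^+ 2)%:A :: s), w, gsP, wP; split=> //.
    by move=> d; rewrite inE => /orP[/eqP ->|/s0 //]; rewrite nug e0.
  apply: (isometric_trans i2); apply: (isometric_trans (osumA _ _ _)).
  apply: osum_isometric; last exact: isometric_refl.
  exact/isometric_sym/diag_cons.
have gwP : ok ((g * t ^+ 2)%:A :: w) by rewrite diag_ok_cons gP.
exists s, ((g * t ^+ 2)%:A :: w), sP, gwP; split=> //.
  by move=> d; rewrite inE => /orP[/eqP ->|/w1 //]; rewrite nug e1.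
apply: (isometric_trans i2); apply: (isometric_trans (osumA _ _ _)).
apply: isometric_trans (osum_isometric (osumC _ _) (isometric_refl _)) _.
apply: isometric_trans (isometric_sym (osumA _ _ _)) _.
apply: osum_isometric; first exact: isometric_refl.
exact/isometric_sym/diag_cons.
Qed.

Lemma two_neq0 (F : fieldType) (c d : F) : 2%:R != 0 :> F -> 2%:R != 0 :> quat c d.
Proof.
by move=> F2; rewrite -[2%:R]scaler_nat scaler_eq0 negb_or F2 oner_neq0.
Qed.

Lemma diagonal_decomposition h :
  exists u w (uP : ok u) (wP : ok w),
    [/\ unramified u, ramified w & isometric h (osum (diag_form uP) (diag_form wP))].
Proof.
have [u [uP i]] := diagonalizable hD (two_neq0 a b n2) h.
have [s [w [sP [wP [s0 w1 i']]]]] := exists_decomposition uP.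
by exists s, w, sP, wP; split=> //; apply: isometric_trans i i'.
Qed.

Lemma residues_exist h : exists r, residues h r.
Proof.
have [u [w [uP [wP [u0 w1 i]]]]] := diagonal_decomposition h.
exact: residues_intro i.
Qed.

Lemma witt_diag_cat u1 u2 (P1 : okbar [seq red c | c <- u1])
    (P2 : okbar [seq red c | c <- u2]) (P : okbar [seq red c | c <- u1 ++ u2]) :
  witt_class (diag_form P) = witt_class (diag_form P1) + witt_class (diag_form P2).
Proof.
have P' : okbar ([seq red c | c <- u1] ++ [seq red c | c <- u2]).
  by rewrite diag_ok_cat P1.
rewrite (diag_form_congr P P') ?map_cat // -witt_classD.
exact/witt_class_isometric/diag_cat.
Qed.

Lemma residues_osum h1 h2 r1 r2 : residues h1 r1 -> residues h2 r2 ->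
  residues (osum h1 h2) (r1 + r2).
Proof.
move=> [u [w [uP [wP [ubP [wbP [u0 w1 i ->]]]]]]].
move=> [s [t [sP [tP [sbP [tbP [s0 t1 j ->]]]]]]].
have usP : ok (u ++ s) by rewrite diag_ok_cat uP.
have wtP : ok (w ++ t) by rewrite diag_ok_cat wP.
have us0 : unramified (u ++ s) by move=> c; rewrite mem_cat => /orP[/u0|/s0].
have wt1 : ramified (w ++ t) by move=> c; rewrite mem_cat => /orP[/w1|/t1].
have usbP := red_ok usP us0.
have wtbP := red_ok (unit_part_ok wtP) (unit_part_unramified wtP wt1).
exists (u ++ s), (w ++ t), usP, wtP, usbP, wtbP; split=> //.
  apply: isometric_trans (osum_isometric i j) _.
  apply: isometric_trans (osumACA _ _ _ _) _.
  by apply: osum_isometric; apply/isometric_sym/diag_cat.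
have wtbP' : okbar [seq red c | c <- unit_part w ++ unit_part t].
  by rewrite -map_cat.
rewrite (witt_diag_cat ubP sbP) (diag_form_congr wtbP wtbP') ?(witt_diag_cat wbP tbP) //.
by congr map; rewrite /unit_part map_cat.
Qed.

Lemma residues_hopp h r : residues h r -> residues (hopp h) (- r).
Proof.
move=> [u [w [uP [wP [ubP [wbP [u0 w1 i ->]]]]]]].
have nuN (c : D) : nu (- c) = nu c.
  by rewrite /nuD; have -> : Nrd (- c) = Nrd c by rewrite /Nrd /=; ring.
have uP' := diag_opp_ok uP; have wP' := diag_opp_ok wP.
have u0' : unramified [seq - c | c <- u].
  by move=> _ /mapP[c cu ->]; rewrite nuN u0.
have w1' : ramified [seq - c | c <- w].
  by move=> _ /mapP[c cw ->]; rewrite nuN w1.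
have ubP' := red_ok uP' u0'.
have wbP' := red_ok (unit_part_ok wP') (unit_part_unramified wP' w1').
have redN s : ok s -> unramified s ->
    [seq red c | c <- [seq - c | c <- s]] = [seq - c | c <- [seq red c | c <- s]].
  move=> sP s0; rewrite -!map_comp; apply/eq_in_map => c cs /=.
  have cO := unramified_int sP s0 cs; apply: (addrI (red c)).
  by rewrite -redD ?qgeN // !subrr red0.
exists [seq - c | c <- u], [seq - c | c <- w], uP', wP', ubP', wbP'; split=> //.
  apply: isometric_trans (hopp_isometric i) _.
  apply: isometric_trans (hopp_osum _ _) _.
  by apply: osum_isometric; apply: diag_opp.
have ubN := diag_opp_ok ubP; have wbN := diag_opp_ok wbP.
rewrite (diag_form_congr ubP' ubN) ?redN // (diag_form_congr wbP' wbN).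
  by rewrite (witt_diag_opp ubP ubN) (witt_diag_opp wbP wbN).
rewrite -redN ?unit_part_ok //; last exact: unit_part_unramified.
by congr map; rewrite /unit_part -!map_comp; apply: eq_map => c /=; rewrite mulNr.
Qed.

Lemma residues_metabolic h r : metabolic h -> residues h r -> r = 0.
Proof.
move=> M [u [w [uP [wP [ubP [wbP [u0 w1 i ->]]]]]]].
have [M0 M1] := metabolic_residues ubP wbP u0 w1 (isometric_metabolic i M).
by rewrite !witt_class_metabolic.
Qed.

(** The form h1 _|_ -h2 is metabolic, and so are its residues. *)
Lemma residues_witt h1 h2 r1 r2 : witt_class h1 = witt_class h2 ->
  residues h1 r1 -> residues h2 r2 -> r1 = r2.
Proof.
move=> e R1 R2; apply/eqP; rewrite -subr_eq0; apply/eqP.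
apply: (residues_metabolic _ (residues_osum R1 (residues_hopp R2))).
apply: (witt0_metabolic hD (two_neq0 a b n2)).
by rewrite witt_classD witt_classN e subrr.
Qed.

Lemma unramified_anisotropic_witt0 u (uP : ok u) (ubP : okbar [seq red c | c <- u]) :
  unramified u -> anisotropic (diag_form uP) -> witt_class (diag_form ubP) = 0 ->
  u = [::].
Proof.
move=> u0 an z; apply: size0nil; rewrite -(size_map red).
apply: (anisotropic_witt0 residue_division (two_neq0 _ _ hchar) _ z).
exact: anisotropic_residue an.
Qed.

(** The values of the two forms differ by the factor pi^-1. *)
Lemma unit_part_anisotropic w (wP : ok w) (wP' : ok (unit_part w)) :
  anisotropic (diag_form wP) -> anisotropic (diag_form wP').
Proof.
move=> an z zz; rewrite -[z]row_downK (an (row_down z)); last first.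
  apply: (mulIr (quat_alg_unit piV0)); rewrite mul0r -[RHS]zz diag_mapE.
  rewrite /= /diag_val mulr_suml; apply: eq_bigr => i _.
  by rewrite -mulrA -quat_alg_comm !mulrA.
by apply/rowP => i; rewrite castmxE !mxE.
Qed.

(** For an anisotropic representative <u> _|_ <w>, the residue forms are anisotropic
    with zero Witt class, so u and w are empty. *)
Lemma residues_injective h : residues h 0 -> witt_class h = 0.
Proof.
move=> R0; have [h' [an' e]] := witt_anisotropic hD (two_neq0 a b n2) h.
have [r R'] := residues_exist h'; have r0 := residues_witt e R' R0.
rewrite {r}r0 in R'; case: R' => [u [w [uP [wP [ubP [wbP [u0 w1 i [zu zw]]]]]]]].
have [anu anw] := osum_anisotropic (isometric_anisotropic i an').
have un := unramified_anisotropic_witt0 u0 anu (esym zu).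
have wn := unramified_anisotropic_witt0 (unit_part_unramified wP w1)
  (unit_part_anisotropic (wP' := unit_part_ok wP) anw) (esym zw).
rewrite -e (witt_class_isometric i) witt_classD.
have z s (sP : ok s) : size s = 0%N -> witt_class (diag_form sP) = 0.
  by move=> s0; apply/witt_class_isometric/hdim0_isometric.
rewrite !z ?addr0 ?un //.
by rewrite -(size_map (fun c => c * (pi^-1)%:A)) -/(unit_part w) wn.
Qed.

(** Symmetric entries are scalars of k, which lift to units of K. *)
Lemma lift_diag ub : okbar ub ->
  exists u, [/\ ok u, unramified u & [seq red c | c <- u] = ub].
Proof.
elim: ub => [|c ub IH] cP; first by exists [::].
have [cP1 ubP] := diag_ok_consP cP; have [u [uP u0 uE]] := IH ubP.
have /andP[/andP[/eqP]] := cP1; rewrite mul1r => /(quat_conj_fixed hchar) cE uc _.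
have [g gO gE] := res_onto hres (qc0 c).
have rg : res g != 0.
  apply: contraTneq uc => g0; rewrite cE -gE g0 scale0r.
  by apply/negP => /unitrP[x [/eqP]]; rewrite mulr0 eq_sym oner_eq0.
have [gn0 vg] := res_unit gO rg.
exists (g%:A :: u); split.
- rewrite diag_ok_cons uP andbT /diag_ok /= andbT mul1r quat_alg_unit // andbT.
  exact/eqP/tau_alg.
- by move=> d; rewrite inE => /orP[/eqP ->|/u0 //]; rewrite nu_alg // vg.
- by rewrite /= red_alg gE -cE uE.
Qed.

Lemma residues_onto r : exists h, residues h r.
Proof.
have lift_class (z : Wbar) : exists u, [/\ ok u, unramified u &
    forall P : okbar [seq red c | c <- u], z = witt_class (diag_form P)].
  have [ub [ubP i]] :=
    diagonalizable residue_division (two_neq0 (res a) (res b) hchar) (repr z).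
  have [u [uP u0 uE]] := lift_diag ubP; exists u; split=> // P.
  by rewrite -[LHS]witt_class_repr (witt_class_isometric i) (diag_form_congr ubP P).
case: r => r0 r1; have [u [uP u0 uE]] := lift_class r0.
have [s [sP s0 sE]] := lift_class r1.
pose w := [seq c * pi%:A | c <- s]; have wP : ok w := scale_okE pi0 sP.
have w1 : ramified w.
  by move=> _ /mapP[c cs ->]; rewrite (nu_scale_diag _ sP) // s0 // vpi add0r.
have ws : unit_part w = s.
  rewrite /unit_part -map_comp -[RHS]map_id; apply: eq_map => c /=.
  by rewrite -mulrA -scalerAl mul1r scalerA mulfV // scale1r mulr1.
have ubP := red_ok uP u0.
have wbP := red_ok (unit_part_ok wP) (unit_part_unramified wP w1).
exists (osum (diag_form uP) (diag_form wP)), u, w, uP, wP, ubP, wbP.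
split=> //; first exact: isometric_refl.
have sbP := red_ok sP s0; rewrite (uE ubP) (sE sbP) (diag_form_congr wbP sbP) //.
by rewrite ws.
Qed.

Definition residue_pair (x : W) : Wbar * Wbar := projT1 (cid (residues_exist (repr x))).

Lemma residue_pairP h r : residues h r -> residue_pair (witt_class h) = r.
Proof.
apply: residues_witt (projT2 (cid (residues_exist (repr (witt_class h))))).
exact: witt_class_repr.
Qed.

Lemma residue_pair_class h : residues h (residue_pair (witt_class h)).
Proof. by have [r R] := residues_exist h; rewrite (residue_pairP R). Qed.

Lemma residue_pair_zmod : zmod_morphism residue_pair.
Proof.
move=> x y; rewrite -[x]witt_class_repr -[y]witt_class_repr.
move: (repr x) (repr y) => h1 h2; rewrite -witt_classN -witt_classD.
apply/residue_pairP/residues_osum; first exact: residue_pair_class.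
exact/residues_hopp/residue_pair_class.
Qed.

Lemma residue_pair_bij : bijective residue_pair.
Proof.
have inj : injective residue_pair.
  move=> x y e; apply/eqP; rewrite -subr_eq0; apply/eqP.
  have : residue_pair (x - y) = 0 by rewrite residue_pair_zmod e subrr.
  rewrite -[x - y]witt_class_repr => z; apply: residues_injective.
  by rewrite -z; apply: residue_pair_class.
have onto r : exists x, residue_pair x = r.
  by have [h R] := residues_onto r; exists (witt_class h); apply: residue_pairP.
exists (fun r => projT1 (cid (onto r))) => x; last exact: projT2 (cid (onto x)).
exact/inj/(projT2 (cid (onto _))).
Qed.

Lemma residue_pair_larmour : larmour_map nu (pi%:A : D) red residue_pair.
Proof.
have nupi : nu (pi%:A : D) = 1 by rewrite nu_alg // vpi.
move=> h; split.
  have [u [w [uP [wP [u0 w1 i]]]]] := diagonal_decomposition h.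
  by exists u, w, uP, wP; split=> //; rewrite nupi.
move=> u w [uP [wP [u0]]]; rewrite nupi => w1 i.
have ubP := red_ok uP u0.
have wbP := red_ok (unit_part_ok wP) (unit_part_unramified wP w1).
have wE : [seq red c | c <- unit_part w] = [seq red (c * pi%:A^-1) | c <- w].
  by rewrite -map_comp; apply: eq_map => c /=; rewrite quat_alg_inv.
have wbP' : okbar [seq red (c * pi%:A^-1) | c <- w] by rewrite -wE.
exists ubP, wbP'; rewrite -(diag_form_congr wbP wbP') //.
by apply: residue_pairP; exists u, w, uP, wP, ubP, wbP.
Qed.

Lemma residue_pair_unit (c : K) : c \in val_units v ->
  exists (cP : ok [:: c%:A]) (cbP : okbar [:: (res c)%:A]),
    (residue_pair (witt_class (diag_form cP))).1 = witt_class (diag_form cbP).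
Proof.
move=> /val_unitsE[cO c0 vc rc]; have cP := scalar_ok c0.
have u0 : unramified [:: c%:A].
  by move=> d; rewrite inE => /eqP ->; rewrite nu_alg // vc.
have cbP := red_ok cP u0; have nP : okbar [seq red d | d <- unit_part [::]] by [].
have redc : [seq red d | d <- [:: c%:A]] = [:: (res c)%:A] by rewrite /= red_alg.
have cbP' : okbar [:: (res c)%:A] by rewrite -redc.
exists cP, cbP'; rewrite -(diag_form_congr cbP cbP') //.
have nP' : ok [::] by [].
rewrite (@residue_pairP _ (witt_class (diag_form cbP), witt_class (diag_form nP))) //.
exists [:: c%:A], [::], cP, nP', cbP, nP; split=> //.
apply: isometric_trans _ (osumC _ _); apply: isometric_sym.
apply: isometric_trans (osum_isometric (diag_nil _) (isometric_refl _)) _.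
exact: osum0h.
Qed.

Lemma residue_pair_uniformizer (c : K) : c != 0 -> v c = 1 ->
  exists (cP : ok [:: c%:A]) (cbP : okbar [:: (res (pi^-1 * c))%:A]),
    (residue_pair (witt_class (diag_form cP))).2 = witt_class (diag_form cbP).
Proof.
move=> c0 vc; have cP := scalar_ok c0.
have w1 : ramified [:: c%:A].
  by move=> d; rewrite inE => /eqP ->; rewrite nu_alg // vc.
have cbP := red_ok (unit_part_ok cP) (unit_part_unramified cP w1).
have nP : okbar [seq red d | d <- [::]] by [].
have redc : [seq red d | d <- unit_part [:: c%:A]] = [:: (res (pi^-1 * c))%:A].
  rewrite /= -red_alg -quat_alg_comm; congr [:: red _].
  by rewrite -scalerAl mul1r scalerA.
have cbP' : okbar [:: (res (pi^-1 * c))%:A] by rewrite -redc.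
exists cP, cbP'; rewrite -(diag_form_congr cbP cbP') //.
have nP' : ok [::] by [].
rewrite (@residue_pairP _ (witt_class (diag_form nP), witt_class (diag_form cbP))) //.
exists [::], [:: c%:A], nP', cP, nP, cbP; split=> //; apply: isometric_sym.
apply: isometric_trans (osum_isometric (diag_nil _) (isometric_refl _)) _.
exact: osum0h.
Qed.

End Uniformizer.

End Division.

End Quaternions.

End Residue.

(** * Larmour's isomorphism *)

Theorem mainTheorem6 (K k : fieldType) (v : K -> int) (res : K -> k)
    (pi a b : K)
    (hv : normalized_valuation v) (hcomplete : val_complete v)
    (hres : residue_map (val_ring v) (val_max v) res)
    (hchar : 2%:R != 0 :> k)
    (hpi : pi != 0 /\ v pi = 1)
    (ha : a \in val_units v) (hb : b \in val_units v)
    (hD : division_ring (quat a b)) :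
  let tau := canonical_involution a b in
  let taubar := canonical_involution (res a) (res b) in
  let red := @quat_red K k res a b in
  let pi' : quat a b := pi%:A in
  division_ring (quat (res a) (res b)) /\
  larmour_setting (nuD v) false tau pi' red taubar taubar /\
  exists del : {additive witt false tau -> (witt false taubar * witt false taubar)%type},
    [/\ larmour_map (nuD v) pi' red del,
        bijective del,
        (forall delta : K, delta \in val_units v ->
           exists (dP : diag_ok false tau [:: delta%:A])
                  (dbP : diag_ok false taubar [:: (res delta)%:A]),
             (del (witt_class (diag_form dP))).1 = witt_class (diag_form dbP))
      & (forall delta : K, delta != 0 -> v delta = 1 ->
           exists (dP : diag_ok false tau [:: delta%:A])
                  (dbP : diag_ok false taubar [:: (res (pi^-1 * delta))%:A]),
             (del (witt_class (diag_form dP))).2 = witt_class (diag_form dbP))].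
Proof.
move=> tau taubar red pi'; have [pi0 vpi] := hpi.
split; first exact: (residue_division hv hres ha hb).
split; first exact: larmour_setting_quat.
pose del0 := residue_pair hv hres ha hb hcomplete hchar hD pi0 vpi.
pose del_additive := GRing.isZmodMorphism.Build _ _ del0
  (residue_pair_zmod hv hres ha hb hcomplete hchar hD pi0 vpi).
pose del : {additive witt false tau -> (witt false taubar * witt false taubar)%type} :=
  HB.pack del0 del_additive.
exists del; split.
- exact: residue_pair_larmour.
- exact: residue_pair_bij.
- exact: residue_pair_unit.
- exact: residue_pair_uniformizer.
Qed.
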